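(* Let $\mathcal H,\mathcal K$ be complex Hilbert spaces and $A\in\mathcal B(\mathcal H,\mathcal K)$. (a) The norm closure of $\{UA: U\in\mathcal U(\mathcal K)\}$ in $\mathcal B(\mathcal H,\mathcal K)$ is the set of all $B\in\mathcal B(\mathcal H,\mathcal K)$ such that $B^*B=A^*A$ and $\iota_f(B)=\iota_f(A)$. (b) The norm closure of $\{AU: U\in\mathcal U(\mathcal H)\}$ in $\mathcal B(\mathcal H,\mathcal K)$ is the set of all $B\in\mathcal B(\mathcal H,\mathcal K)$ such that $BB^*=AA^*$ and $\iota_i(B)=\iota_i(A)$.
   Context: Hilbert spaces are complex and of arbitrary dimension; $\dim$ is the Hilbert space dimension (the cardinality of an orthonormal basis), and sums of dimensions are cardinal sums. $\mathcal B(\mathcal H,\mathcal K)$ is the space of bounded linear operators $\mathcal H\to\mathcal K$ with the operator norm. $\mathcal U(\mathcal H)$ is the unitary group of $\mathcal H$. $\mathcal N(A)$, $\mathcal R(A)$, $\overline{\mathcal R}(A)$ denote the kernel, the range and the closure of the range of $A$. For a pre-Hilbert space $\mathcal E$ with completion $\overline{\mathcal E}$, $\mathrm{IC}(\mathcal E)=\min\{\dim(\overline{\mathcal E}\ominus V): V \text{ a complete linear subspace of }\mathcal E\}$ ($\ominus$ denotes orthogonal complement). For $A\in\mathcal B(\mathcal H,\mathcal K)$: $\iota_i(A)=\dim\mathcal N(A)+\mathrm{IC}(\mathcal R(A))$ and $\iota_f(A)=\dim(\mathcal K\ominus\overline{\mathcal R}(A))+\mathrm{IC}(\mathcal R(A))$.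 *)

(* Defs.v *)
From HB Require Import structures.
From mathcomp Require Import all_boot all_order all_algebra sesquilinear.
From mathcomp Require Import all_classical all_reals all_analysis.
From mathcomp Require Import complex.

Set Implicit Arguments.
Unset Strict Implicit.
Unset Printing Implicit Defensive.

Import Order.TTheory GRing.Theory Num.Theory.
Import numFieldNormedType.Exports.

Local Open Scope classical_set_scope.
Local Open Scope complex_scope.
Local Open Scope ring_scope.

Definition bounded_linear (R : realType) (E F : normedModType R[i]) :
    {pred E -> F} :=
  mem [set f : E -> F | linear f /\
    exists M : R, forall x, `|f x| <= M%:C * `|x|].

Lemma bounded_linearP (R : realType) (E F : normedModType R[i]) (f : E -> F) :
  f \in @bounded_linear R E F <->
  linear f /\ exists M : R, forall x, `|f x| <= M%:C * `|x|.
Proof. by rewrite inE. Qed.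

Lemma bounded_linear_submod (R : realType) (E F : normedModType R[i]) :
  submod_closed (@bounded_linear R E F).
Proof.
split=> [|a f g].
  apply/bounded_linearP; split=> [b x y|]; first by rewrite /= scaler0 addr0.
  by exists 0 => x; rewrite /= normr0 mul0r.
move=> /bounded_linearP[fL [M fM]] /bounded_linearP[gL [N gN]].
apply/bounded_linearP; split=> [b x y|].
  rewrite [LHS](_ : _ = a *: f (b *: x + y) + g (b *: x + y))//.
  rewrite [RHS](_ : _ = b *: (a *: f x + g x) + (a *: f y + g y))//.
  by rewrite fL gL !scalerDr !scalerA [b * a]mulrC addrACA.
have [r ra] : exists r : R, `|a| = r%:C.
  by apply/complex_realP; rewrite normr_real.
exists (r * M + N) => x.
rewrite (le_trans (ler_normD _ _))// rmorphD rmorphM/= mulrDl lerD//.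
by rewrite -ra normrZ -mulrA ler_wpM2l.
Qed.

HB.instance Definition _ (R : realType) (E F : normedModType R[i]) :=
  GRing.isSubmodClosed.Build R[i] (E -> F) (@bounded_linear R E F)
    (@bounded_linear_submod R E F).

Section BoundedOp.
Variables (R : realType) (E F : normedModType R[i]).

Record bounded_op := BoundedOp {
  bounded_op_fun :> E -> F;
  bounded_op_mem : bounded_op_fun \in @bounded_linear R E F }.

HB.instance Definition _ := [isSub for bounded_op_fun].
HB.instance Definition _ := [Choice of bounded_op by <:].
HB.instance Definition _ := [SubChoice_isSubLmodule of bounded_op by <:].

Lemma bounded_op_linear (f : bounded_op) : linear f.
Proof. by have /bounded_linearP[] := bounded_op_mem f. Qed.

HB.instance Definition _ (f : bounded_op) :=
  GRing.isLinear.Build R[i] E F *:%R (bounded_op_fun f) (bounded_op_linear f).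

Lemma bounded_opP (f : bounded_op) :
  exists M : R, forall x, `|f x| <= M%:C * `|x|.
Proof. by have /bounded_linearP[] := bounded_op_mem f. Qed.

Lemma bounded_op_eqP (f g : bounded_op) : f = g <-> f =1 g.
Proof. by split=> [->//|fg]; apply/val_inj/funext. Qed.

(* Norms of normed modules over [R[i]] take their values in [R[i]]; they are
   nonnegative reals, hence [complex.Re] to compute the supremum in [R]. *)
Definition opnorm (f : E -> F) : R :=
  sup [set complex.Re `|f x| | x in [set x : E | `|x| <= 1]].

Lemma has_sup_opnorm (f : bounded_op) :
  has_sup [set complex.Re `|f x| | x in [set x : E | `|x| <= 1]].
Proof.
split; first by exists (complex.Re `|f 0|), 0 => //=; rewrite normr0.
have [M fM] := bounded_opP f; exists `|M| => _ [x /= x1 <-].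
rewrite -lecR RRe_real ?normr_real// (le_trans (fM x))//.
have M0 : M%:C <= `|M|%:C by rewrite lecR ler_norm.
rewrite (le_trans (ler_wpM2r _ M0))// ler_piMr//.
by rewrite lecR.
Qed.

Lemma opnorm_ge (f : bounded_op) x : `|x| <= 1 -> `|f x| <= (opnorm f)%:C.
Proof.
move=> x1; rewrite -[leLHS]RRe_real ?normr_real// lecR.
by apply: sup_upper_bound; [exact: has_sup_opnorm|exists x].
Qed.

Lemma opnorm_le (f : bounded_op) (M : R) :
  (forall x, `|x| <= 1 -> `|f x| <= M%:C) -> opnorm f <= M.
Proof.
move=> fM; apply: ge_sup; first by case: (has_sup_opnorm f).
by move=> _ [x /= x1 <-]; rewrite -lecR RRe_real ?normr_real// fM.
Qed.

Lemma opnorm_ge0 (f : bounded_op) : 0 <= opnorm f.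
Proof.
rewrite -lecR (le_trans _ (@opnorm_ge f 0 _)) ?normr0//.
Qed.

Lemma opnormP (f : bounded_op) x : `|f x| <= (opnorm f)%:C * `|x|.
Proof.
have [->|x0] := eqVneq x 0; first by rewrite linear0 !normr0 mulr0.
have nx : 0 < `|x| by rewrite normr_gt0.
have := @opnorm_ge f (`|x|^-1 *: x) _.
rewrite linearZ !normrZ normfV normr_id mulVf ?gt_eqF// => /(_ (lexx _)).
by rewrite mulrC ler_pdivrMr.
Qed.

Let norm (f : bounded_op) : R[i] := (opnorm f)%:C.

Let ler_normD f g : norm (f + g) <= norm f + norm g.
Proof.
rewrite /norm -rmorphD lecR; apply: opnorm_le => x x1.
by rewrite (le_trans (ler_normD _ _))// rmorphD lerD// opnorm_ge.
Qed.

Let normrZ_le a f : norm (a *: f) <= `|a| * norm f.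
Proof.
have [r ra] : exists r : R, `|a| = r%:C.
  by apply/complex_realP; rewrite normr_real.
rewrite ra /norm -rmorphM lecR; apply: opnorm_le => x x1.
rewrite [`|(_ : bounded_op) x|]normrZ ra rmorphM/= ler_wpM2l ?opnorm_ge//.
by rewrite -ra.
Qed.

Let normrZ a f : norm (a *: f) = `|a| * norm f.
Proof.
apply/le_anti; rewrite normrZ_le/=.
have [->|a0] := eqVneq a 0.
  by rewrite normr0 mul0r lecR opnorm_ge0.
have := normrZ_le a^-1 (a *: f).
by rewrite scalerA mulVf// scale1r normfV mulrC ler_pdivlMr ?normr_gt0// mulrC.
Qed.

Let normr0_eq0 f : norm f = 0 -> f = 0.
Proof.
move=> f0; apply/bounded_op_eqP => x; apply/eqP.
by rewrite -normr_le0 (le_trans (opnormP f x))// [X in X * _]f0 mul0r.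
Qed.

HB.instance Definition _ :=
  Lmodule_isNormed.Build R[i] bounded_op ler_normD normrZ normr0_eq0.

Lemma bounded_op_normE (f : bounded_op) : `|f| = (opnorm f)%:C.
Proof. by []. Qed.

End BoundedOp.

Section BoundedOpComp.
Variable R : realType.

Lemma bounded_comp_subproof (E F G : normedModType R[i])
    (g : bounded_op F G) (f : bounded_op E F) :
  g \o f \in @bounded_linear R E G.
Proof.
apply/bounded_linearP; split=> [a x y|]; first by rewrite /= !linearP.
exists (opnorm g * opnorm f) => x; rewrite /= rmorphM -mulrA.
rewrite (le_trans (opnormP g _))// ler_wpM2l ?opnormP//.
by rewrite lecR opnorm_ge0.
Qed.

Definition bounded_comp (E F G : normedModType R[i])
    (g : bounded_op F G) (f : bounded_op E F) : bounded_op E G :=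
  BoundedOp (bounded_comp_subproof g f).

Lemma bounded_id_subproof (E : normedModType R[i]) :
  id \in @bounded_linear R E E.
Proof.
by apply/bounded_linearP; split=> //; exists 1 => x; rewrite mul1r.
Qed.

Definition bounded_id (E : normedModType R[i]) : bounded_op E E :=
  BoundedOp (bounded_id_subproof E).

End BoundedOpComp.
Arguments bounded_id {R E}.

Notation "g \oB f" := (bounded_comp g f)
  (at level 50, format "g  \oB  f").

HB.mixin Record NormedModule_isPreHilbert (R : realType) V
    of NormedModule R[i] V := {
  inner : {dot V for @Num.conj R[i]};
  innerE : forall x : V, inner x x = `|x| ^+ 2
}.

#[short(type="hilbertType")]
HB.structure Definition Hilbert (R : realType) :=
  {V of CompleteNormedModule R[i] V & NormedModule_isPreHilbert R V}.

Notation "''[' x , y ]" := (inner x y) (format "''[' x ,  y ]").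

Section Adjoint.
Variables (R : realType) (H K : hilbertType R).

Definition is_adjoint (A : bounded_op H K) (B : bounded_op K H) :=
  forall x y, '[A x, y] = '[x, B y].

(* The default [0] is never used: the adjoint exists by the Riesz theorem and
   is unique. *)
Definition adjoint (A : bounded_op H K) : bounded_op K H :=
  xget 0 [set B | is_adjoint A B].

End Adjoint.

Definition unitary_op (R : realType) (H : hilbertType R)
    (U : bounded_op H H) :=
  adjoint U \oB U = bounded_id /\ U \oB adjoint U = bounded_id.

Section HilbertDim.
Variables (R : realType) (H : hilbertType R).
Implicit Types (E V S : set H).

Definition subspace V := submod_closed (mem V).

Definition lspan S : set H := smallest subspace S.

Definition orthonormal_set S :=
  forall x y, S x -> S y -> '[x, y] = (x == y)%:R.

Definition orthonormal_basis V S :=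
  [/\ S `<=` V, orthonormal_set S & V `<=` closure (lspan S)].

(* Cardinals are represented by sets, to be compared with [#<=] and [#=]. The
   Hilbert dimension of a closed subspace [V] is represented by one of its
   orthonormal bases; they all have the same cardinality. *)
Definition hdim V : set H := xget set0 (orthonormal_basis V).

(* The part of [E] orthogonal to [V]. *)
Definition ominus E V : set H :=
  [set x | E x /\ forall y, V y -> '[x, y] = 0].

Definition complete_set V :=
  forall F : set_system H, ProperFilter F -> F V -> cauchy F ->
    exists2 x, V x & F --> x.

Definition complete_subspace_of E V :=
  [/\ V `<=` E, subspace V & complete_set V].

(* The completion of a linear subspace [E] of [H] is its closure in [H]. The
   minimum of this class of cardinals is attained. *)
Definition IC E : set H :=
  let codims :=
    [set hdim (ominus (closure E) V) | V in complete_subspace_of E] in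
  xget set0 [set c | codims c /\ forall d, codims d -> c #<= d]%card.

End HilbertDim.

Definition card_sum (T U : Type) (A : set T) (B : set U) : set (T + U) :=
  inl @` A `|` inr @` B.

Section Indices.
Variables (R : realType) (H K : hilbertType R) (A : bounded_op H K).

Definition iota_i : set (H + K) :=
  card_sum (hdim (A @^-1` [set 0])) (IC (range A)).

Definition iota_f : set (K + K) :=
  card_sum (hdim (ominus [set: K] (closure (range A)))) (IC (range A)).

End Indices.

(* Main.v *)
Require Import Defs.
From HB Require Import structures.
From mathcomp Require Import all_boot all_order all_algebra sesquilinear.
From mathcomp Require Import all_classical all_reals all_analysis.
From mathcomp Require Import complex.
From mathcomp Require Import ring lra.
Import Defs.

(** Write [E] for the range of [A]. If [B] satisfies [B^* B = A^* A], then
[A x |-> B x] is an isometry between the ranges, and [B] is a norm limit of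
operators [U A] with [U] unitary when this isometry can be followed by
unitaries on larger and larger parts of [E]. A unitary can follow an isometry
on a complete subspace [V] of [E], with image [V'], as soon as the orthogonal
complements of [V] and [V'] have the same dimension
([unitary_extension]). The complement of [V] is the complement of [E] plus the
part of the closure of [E] orthogonal to [V], so that its dimension is
[iota_f A] when [V] is optimal for [IC E].

Optimal subspaces can be found that carry almost all of [A]. Cutting the
spectrum of [A^* A] at [e^2] gives a subspace [X] of the source on which [A] is
bounded below by [e], with [A] at most [e] on the complement and with
orthogonal images ([spectral_cut]); the cut is obtained from the modulus of a
self-adjoint contraction ([modulus_exists]). For [e] small, [A X] is optimal
([IC_attained_near]): an optimal [V] consists of images of vectors of
controlled norm ([open_mapping]), hence contains no nonzero vector orthogonal
to [A X]. The same [X] serves for [B], whose Gram operator is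
that of [A], so equality of the indices gives a unitary taking [A] to [B] on
[X] and hence up to [2 e] everywhere.

Conversely, if [U A] is close to [B] and [V] is optimal for [A], then the
subspaces [U V] and [V' = B (A^-1 V)] are so close that no nonzero vector of
[U V] is orthogonal to [V']; comparing complements gives
[iota_f B <= iota_f A] ([iota_f_le_of_near]), and the situation is symmetric.
All comparisons of dimensions reduce to one principle: [V] is not larger than
[W] when some bounded operator sends no nonzero vector of [V] into the
complement of [W] ([onb_le]).

The statement on [A U] is the first one for adjoints, since taking adjoints is
isometric and [IC] takes the same value on the ranges of [A] and [A^*]
([IC_adjoint_le]). *)

Set Implicit Arguments.
Unset Strict Implicit.
Unset Printing Implicit Defensive.

Import Order.TTheory GRing.Theory Num.Theory.
Import numFieldNormedType.Exports.

Local Open Scope classical_set_scope.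
Local Open Scope card_scope.
Local Open Scope complex_scope.
Local Open Scope ring_scope.

(** * Real-valued norm and inner product *)

Section RealNorm.
Variable R : realType.

(** Norms of modules over [R[i]] are complex numbers; their real parts live in
an ordered field, where linear arithmetic applies. *)
Definition nrm (E : normedModType R[i]) (x : E) : R := complex.Re `|x|.

Section Normed.
Variable E : normedModType R[i].
Implicit Types x y : E.

Lemma normE x : `|x| = (nrm x)%:C.
Proof. by rewrite /nrm RRe_real ?normr_real. Qed.

Lemma nrm_ge0 x : 0 <= nrm x.
Proof. by rewrite -lecR -normE; exact: normr_ge0. Qed.

Lemma nrm0 : nrm (0 : E) = 0.
Proof. by rewrite /nrm normr0. Qed.

Lemma nrm_eq0 x : (nrm x == 0) = (x == 0).
Proof. by rewrite -[RHS]normr_eq0 normE eq_complex /= eqxx andbT. Qed.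

Lemma nrm_gt0 x : (0 < nrm x) = (x != 0).
Proof. by rewrite lt_def nrm_ge0 andbT nrm_eq0. Qed.

Lemma nrm_le0 x : nrm x <= 0 -> x = 0.
Proof.
move=> h; apply/eqP; rewrite -nrm_eq0; apply/eqP/le_anti.
by rewrite h nrm_ge0.
Qed.

Lemma nrmN x : nrm (- x) = nrm x.
Proof. by rewrite /nrm normrN. Qed.

Lemma nrmBC x y : nrm (x - y) = nrm (y - x).
Proof. by rewrite /nrm distrC. Qed.

Lemma nrmD x y : nrm (x + y) <= nrm x + nrm y.
Proof. by rewrite -lecR rmorphD/= -!normE ler_normD. Qed.

Lemma nrmB x y : nrm (x - y) <= nrm x + nrm y.
Proof. by rewrite -lecR rmorphD/= -!normE ler_normB. Qed.

Lemma nrm_tri y x z : nrm (x - z) <= nrm (x - y) + nrm (y - z).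
Proof. by rewrite (_ : x - z = (x - y) + (y - z)) ?nrmD// addrA subrK. Qed.

Lemma nrmZ (a : R[i]) x : nrm (a *: x) = complex.Re `|a| * nrm x.
Proof.
apply: (@complexI R); rewrite rmorphM/= -!normE normrZ; congr (_ * _).
Qed.

Lemma nrmZr (a : R) x : nrm (a%:C *: x) = `|a| * nrm x.
Proof. by rewrite nrmZ normc_def/= expr0n addr0 sqrtr_sqr. Qed.

Lemma nrm_closureP (A : set E) x :
  closure A x <-> forall e : R, 0 < e -> exists2 y, A y & nrm (x - y) < e.
Proof.
split=> [clA e e0|h B /nbhs_ballP[e /= e0 eB]].
  have : nbhs x (ball x e%:C) by apply: nbhsx_ballx; rewrite ltcR.
  move=> /clA[y [Ay]]; rewrite -ball_normE /= => xy.
  by exists y => //; rewrite -ltcR -normE.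
have eE : e = (complex.Re e)%:C by rewrite RRe_real ?gtr0_real.
have [|y Ay xy] := h (complex.Re e); first by rewrite -ltcR -eE.
exists y; split=> //; apply: eB; rewrite -ball_normE /=.
by rewrite normE eE ltcR.
Qed.

End Normed.

(** Completeness without sequences: [F e] collects the approximations of
precision [e], and any two approximations agree up to the sum of their
precisions. *)
Lemma cauchy_family (E : completeNormedModType R[i]) (F : R -> set E) :
  (forall e, 0 < e -> F e !=set0) ->
  (forall e d x y, 0 < e -> 0 < d -> F e x -> F d y -> nrm (x - y) <= e + d) ->
  exists l, forall e x, 0 < e -> F e x -> nrm (x - l) <= e.
Proof.
move=> F0 FF.
pose G : set_system E :=
  [set A | exists2 e : R, 0 < e & forall d, 0 < d -> d <= e -> F d `<=` A].
have PG : ProperFilter G.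
  split.
    move=> [e e0 /(_ e e0 (lexx _)) Fe].
    by have [x /Fe] := F0 _ e0.
  split.
  - by exists 1.
  - move=> A B [e e0 eA] [d d0 dB]; exists (Num.min e d).
      by rewrite lt_min e0 d0.
    move=> c c0; rewrite le_min => /andP[ce cd] x Fx.
    by split; [exact: (eA c)|exact: (dB c)].
  - move=> A B AB [e e0 eA]; exists e => // d d0 de x Fx.
    exact/AB/(eA d).
have : cauchy G.
  apply: cauchy_exP => e e0.
  have eE : e = (complex.Re e)%:C by rewrite RRe_real ?gtr0_real.
  have e'0 : 0 < complex.Re e by rewrite -ltcR -eE.
  set r := complex.Re e in e'0 eE.
  have [x Fx] := F0 (r / 3) ltac:(lra).
  exists x; exists (r / 3); first lra.
  move=> d d0 de y Fy; rewrite -ball_normE /= normE eE ltcR.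
  apply: (le_lt_trans (FF _ _ _ _ _ _ Fx Fy)) => //; lra.
move=> /cauchy_cvgP /cvg_ex[l Gl]; exists l => e x e0 Fx.
apply/ler_addgt0Pr => d d0.
have : nbhs l (ball l (d / 2)%:C) by apply: nbhsx_ballx; rewrite ltcR; lra.
move=> /Gl[c c0 cF].
have m0 : 0 < Num.min c (d / 2) by rewrite lt_min c0; lra.
have [y Fy] := F0 _ m0.
have := cF _ m0 _ y Fy; rewrite -ball_normE/= normE ltcR ge_min lexx => /(_ isT).
rewrite nrmBC => yl.
have xy := FF _ _ _ _ e0 m0 Fx Fy.
have mx : Num.min c (d / 2) <= d / 2 by rewrite ge_min lexx orbT.
have := nrm_tri y x l; lra.
Qed.

End RealNorm.

Section InnerTheory.
Variables (R : realType) (H : hilbertType R).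
Implicit Types x y z : H.

Definition rdot x y : R := complex.Re '[x, y].

Lemma innerDl x y z : '[x + y, z] = '[x, z] + '[y, z].
Proof. exact: linearDl. Qed.
Lemma innerDr x y z : '[z, x + y] = '[z, x] + '[z, y].
Proof. exact: linearDr. Qed.
Lemma innerBl x y z : '[x - y, z] = '[x, z] - '[y, z].
Proof. exact: linearBl. Qed.
Lemma innerBr x y z : '[z, x - y] = '[z, x] - '[z, y].
Proof. exact: linearBr. Qed.
Lemma innerNl x y : '[- x, y] = - '[x, y].
Proof. exact: linearNl. Qed.
Lemma innerNr x y : '[y, - x] = - '[y, x].
Proof. exact: linearNr. Qed.
Lemma inner0l x : '[0, x] = 0.
Proof. exact: linear0l. Qed.
Lemma inner0r x : '[x, 0] = 0.
Proof. exact: linear0r. Qed.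
Lemma innerZl a x y : '[a *: x, y] = a * '[x, y].
Proof. by rewrite linearZl_LR. Qed.
Lemma innerZr a x y : '[x, a *: y] = Num.conj a * '[x, y].
Proof. by rewrite linearZr_LR. Qed.
Lemma inner_suml (I : Type) (r : seq I) (F : I -> H) y :
  '[\sum_(i <- r) F i, y] = \sum_(i <- r) '[F i, y].
Proof. exact: linear_sumlz. Qed.
Lemma innerC x y : '[x, y] = Num.conj '[y, x].
Proof. by have := @hermitian_subproof _ _ _ _ (@inner R H) x y; rewrite mul1r. Qed.

Lemma inner0C x y : '[x, y] = 0 -> '[y, x] = 0.
Proof. by move=> xy; rewrite innerC xy rmorph0. Qed.

Lemma inner_nrm x : '[x, x] = (nrm x ^+ 2)%:C.
Proof. by rewrite innerE normE rmorphXn. Qed.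

Lemma inner_eq0 x : '[x, x] = 0 -> x = 0.
Proof.
rewrite inner_nrm => h; apply/eqP; rewrite -nrm_eq0 -sqrf_eq0.
by apply/eqP/(@complexI R).
Qed.

Lemma rdotC x y : rdot x y = rdot y x.
Proof. by rewrite /rdot innerC; case: '[y, x]. Qed.

Lemma rdotDl x y z : rdot (x + y) z = rdot x z + rdot y z.
Proof. by rewrite /rdot innerDl raddfD. Qed.
Lemma rdotBl x y z : rdot (x - y) z = rdot x z - rdot y z.
Proof. by rewrite /rdot innerBl raddfB. Qed.
Lemma rdotDr x y z : rdot z (x + y) = rdot z x + rdot z y.
Proof. by rewrite /rdot innerDr raddfD. Qed.
Lemma rdotBr x y z : rdot z (x - y) = rdot z x - rdot z y.
Proof. by rewrite /rdot innerBr raddfB. Qed.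
Lemma rdotZl (a : R) x y : rdot (a%:C *: x) y = a * rdot x y.
Proof. by rewrite /rdot innerZl; case: '[x, y] => u v /=; rewrite mul0r subr0. Qed.
Lemma rdotZr (a : R) x y : rdot x (a%:C *: y) = a * rdot x y.
Proof. by rewrite rdotC rdotZl rdotC. Qed.
Lemma rdotxx x : rdot x x = nrm x ^+ 2.
Proof. by rewrite /rdot inner_nrm. Qed.

Lemma rdot0 x y : '[x, y] = 0 -> rdot x y = 0.
Proof. by rewrite /rdot => ->. Qed.

Lemma nrm_sqD x y : nrm (x + y) ^+ 2 = nrm x ^+ 2 + nrm y ^+ 2 + rdot x y *+ 2.
Proof. by rewrite -!rdotxx !(rdotDl, rdotDr) (rdotC y x); ring. Qed.

Lemma nrm_sqB x y : nrm (x - y) ^+ 2 = nrm x ^+ 2 + nrm y ^+ 2 - rdot x y *+ 2.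
Proof. by rewrite -!rdotxx !(rdotBl, rdotBr) (rdotC y x); ring. Qed.

Lemma pythagoras x y : '[x, y] = 0 -> nrm (x + y) ^+ 2 = nrm x ^+ 2 + nrm y ^+ 2.
Proof. by move=> /rdot0 xy; rewrite nrm_sqD xy mul0rn addr0. Qed.

Lemma nrm_orthoDl x y : '[x, y] = 0 -> nrm x <= nrm (x + y).
Proof.
move=> xy; rewrite -ler_sqr ?nnegrE ?nrm_ge0// pythagoras//.
by rewrite lerDl sqr_ge0.
Qed.

Lemma cauchy_schwarz x y : rdot x y <= nrm x * nrm y.
Proof.
have [->|y0] := eqVneq y 0; first by rewrite /rdot inner0r nrm0 mulr0.
have := sqr_ge0 (nrm ((nrm y)%:C *: x - (nrm x)%:C *: y)).
rewrite nrm_sqB !nrmZr !ger0_norm ?nrm_ge0// rdotZl rdotZr.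
have := nrm_ge0 x; have : 0 < nrm y by rewrite nrm_gt0.
have [->|] := eqVneq x 0; first by rewrite /rdot inner0l nrm0 mul0r.
rewrite -nrm_gt0; move: (nrm x) (nrm y) (rdot x y) => a b c a0 b0 _.
rewrite (_ : _ - _ = (a * b) * ((a * b - c) *+ 2)); last ring.
by rewrite pmulr_rge0 ?mulr_gt0// pmulrn_lge0// subr_ge0.
Qed.

End InnerTheory.

(** Real parts of inner products against all multiples of a vector, namely
against itself and [i] times itself, determine the complex inner product. *)
Lemma inner_eq_rdot (R : realType) (H K : hilbertType R) (x y : H) (x' y' : K) :
  (forall a : R[i], rdot x (a *: y) = rdot x' (a *: y')) -> '[x, y] = '[x', y'].
Proof.
move=> h; have := h 1; rewrite !scale1r /rdot => h1.
have := h 'i; rewrite /rdot !innerZr.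
case: '[x, y] h1 => a b /=; case: '[x', y'] => c d /=.
by move=> -> ; rewrite !(mul0r, mulN1r, opprK, sub0r) /= => ->.
Qed.

Lemma inner0_rdot (R : realType) (H : hilbertType R) (x y : H) :
  (forall a : R[i], rdot x (a *: y) = 0) -> '[x, y] = 0.
Proof.
move=> h; rewrite -(inner0l y); apply: inner_eq_rdot => a.
by rewrite h /rdot inner0l.
Qed.

(** * Closed subspaces and orthogonal projection *)

Section Subspaces.
Variables (R : realType) (H : hilbertType R).
Implicit Types (x y z : H) (V W : set H).

Definition closed_subspace V := subspace V /\ closed V.

Definition orth V : set H := [set x | forall y, V y -> '[x, y] = 0].

Lemma ominusE V W : ominus V W = V `&` orth W.
Proof. by []. Qed.

Lemma ominusT V : ominus [set: H] V = orth V.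
Proof. by rewrite ominusE setTI. Qed.

Lemma subspaceP V : subspace V <->
  V 0 /\ forall a x y, V x -> V y -> V (a *: x + y).
Proof.
split=> [[V0 VD]|[V0 VD]].
  split; first by move: V0; rewrite in_setE.
  by move=> a x y Vx Vy; have := VD a x y; rewrite !in_setE; apply.
by split=> [|a x y]; rewrite !in_setE//; exact: VD.
Qed.

Lemma subspace0 V : subspace V -> V 0.
Proof. by move=> /subspaceP[]. Qed.

Lemma subspaceZ V a x : subspace V -> V x -> V (a *: x).
Proof.
by move=> /subspaceP[V0 VD] Vx; rewrite -[_ *: _]addr0; exact: VD.
Qed.

Lemma subspaceD V x y : subspace V -> V x -> V y -> V (x + y).
Proof. by move=> /subspaceP[V0 VD] Vx; rewrite -[x]scale1r; exact: VD. Qed.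

Lemma subspaceB V x y : subspace V -> V x -> V y -> V (x - y).
Proof.
by move=> sV Vx Vy; apply: subspaceD => //; rewrite -scaleN1r; exact: subspaceZ.
Qed.

Lemma closed_approx V x : closed V ->
  (forall e : R, 0 < e -> exists2 y, V y & nrm (x - y) < e) -> V x.
Proof. by move=> cV h; apply: cV; apply/nrm_closureP. Qed.

Lemma closed_approxP V :
  (forall x, (forall e : R, 0 < e -> exists2 y, V y & nrm (x - y) < e) -> V x) ->
  closed V.
Proof. by move=> h x /nrm_closureP/h. Qed.

Lemma closure_subspace V : subspace V -> closed_subspace (closure V).
Proof.
move=> sV; split; last exact: closed_closure.
apply/subspaceP; split; first by apply: subset_closure; exact: subspace0.
move=> a x y /nrm_closureP cx /nrm_closureP cy; apply/nrm_closureP => e e0.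
have na0 := nrm_ge0 (a : R[i]^o).
pose d := e / (2 * (complex.Re `|a| + 1)).
have ra0 : 0 <= complex.Re `|a| by exact: na0.
have d0 : 0 < d by rewrite divr_gt0//; lra.
have [x' Vx' xx'] := cx _ d0; have [|y' Vy' yy'] := cy (e / 2); first lra.
exists (a *: x' + y'); first by apply: subspaceD => //; exact: subspaceZ.
rewrite opprD addrACA -scalerBr (le_lt_trans (nrmD _ _))// nrmZ.
have : complex.Re `|a| * nrm (x - x') <= complex.Re `|a| * d.
  by rewrite ler_wpM2l// ltW.
have : complex.Re `|a| * d <= e / 2.
  rewrite /d mulrA ler_pdivrMr; last lra.
  by nra.
lra.
Qed.

Lemma closure_closed_subspace V : closed_subspace V -> closure V = V.
Proof. by move=> [_ /closure_id]. Qed.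

Lemma half_double x : (2^-1)%:C *: (x + x) = x.
Proof.
by rewrite -mulr2n -[x *+ 2]scaler_nat scalerA fmorphV rmorph_nat mulVf ?pnatr_eq0 ?scale1r.
Qed.

Lemma inner0_le x y : (forall a : R[i], rdot x (a *: y) <= 0) -> '[x, y] = 0.
Proof.
move=> h; apply: inner0_rdot => a; apply/le_anti; rewrite h/=.
have := h (- a).
by rewrite scaleNr /rdot innerNr raddfN oppr_le0.
Qed.

Lemma orth_closed_subspace V : closed_subspace (orth V).
Proof.
split.
  apply/subspaceP; split=> [y _|a x y Vx Vy z Vz]; first by rewrite inner0l.
  by rewrite innerDl innerZl Vx// Vy// mulr0 addr0.
apply: closed_approxP => x h y Vy.
apply: inner0_le => a; apply/ler_addgt0Pr => e e0; rewrite add0r.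
have n0 := nrm_ge0 (a *: y).
have [|x' Vx' xx'] := h (e / (nrm (a *: y) + 1)); first by rewrite divr_gt0//; lra.
have -> : rdot x (a *: y) = rdot (x - x') (a *: y).
  by rewrite rdotBl [X in _ - X]rdot0 ?subr0// innerZr Vx' ?mulr0.
apply: (le_trans (cauchy_schwarz _ _)).
apply: (@le_trans _ _ (e / (nrm (a *: y) + 1) * nrm (a *: y))).
  by rewrite ler_wpM2r// ltW.
by rewrite mulrAC ler_pdivrMr; [nra|lra].
Qed.

Lemma subset_orth V W : V `<=` W -> orth W `<=` orth V.
Proof. by move=> VW x Wx y /VW; exact: Wx. Qed.

Lemma orth_sym V x y : V x -> orth V y -> '[x, y] = 0.
Proof. by move=> Vx Wy; rewrite inner0C// Wy. Qed.

Lemma subset_orth2 V : V `<=` orth (orth V).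
Proof. by move=> x Vx y Vy; rewrite (orth_sym Vx). Qed.

Lemma orth_closure V : orth (closure V) = orth V.
Proof.
apply/seteqP; split; first by apply: subset_orth; exact: subset_closure.
move=> x Vx y cy.
have [_ co] := orth_closed_subspace (orth V).
have /co yVV : closure (orth (orth V)) y.
  by apply: closure_subset cy; exact: subset_orth2.
by rewrite (orth_sym Vx).
Qed.

Lemma closed_subspace0 : closed_subspace [set (0 : H)].
Proof.
split; first by apply/subspaceP; split=> // a x y -> ->; rewrite scaler0 addr0.
apply: closed_approxP => x h; apply: nrm_le0; apply/ler_addgt0Pr => e e0.
by have [_ ->] := h e e0; rewrite subr0 add0r => /ltW.
Qed.

Lemma closed_subspaceI V W : closed_subspace V -> closed_subspace W ->
  closed_subspace (V `&` W).
Proof.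
move=> [/subspaceP[V0 VD] cV] [/subspaceP[W0 WD] cW]; split; last exact: closedI.
by apply/subspaceP; split=> // a x y [? ?] [? ?]; split; [exact: VD|exact: WD].
Qed.

Lemma ominus_closed_subspace V W : closed_subspace V -> closed_subspace (ominus V W).
Proof. by move=> cV; apply: closed_subspaceI => //; exact: orth_closed_subspace. Qed.

Lemma orth_cap V x : V x -> orth V x -> x = 0.
Proof. by move=> Vx /(_ _ Vx)/inner_eq0. Qed.

(** A minimising family for the distance from [x] to [V] is Cauchy by the
parallelogram law, and its limit is the foot of the perpendicular. *)
Lemma orth_projection V x : closed_subspace V -> exists2 v, V v & orth V (x - v).
Proof.
move=> [sV cV]; pose D := [set nrm (x - v) ^+ 2 | v in V].
have D0 : has_inf D.
  split; first by exists (nrm (x - 0) ^+ 2), 0 => //; exact: subspace0.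
  by exists 0 => _ [v _ <-]; exact: sqr_ge0.
have Dle v : V v -> inf D <= nrm (x - v) ^+ 2.
  by move=> Vv; apply: ge_inf; [exact: D0.2|exists v].
pose F e := [set v | V v /\ nrm (x - v) ^+ 2 < inf D + e ^+ 2 / 2].
have [||l lF] := @cauchy_family R H F.
- move=> e e0; have [|_ [v Vv <-] vD] := @inf_adherent _ _ (e ^+ 2 / 2) _ D0.
    by rewrite divr_gt0 ?exprn_gt0.
  by exists v.
- move=> e d v w e0 d0 [Vv vF] [Vw wF].
  have e0' := ltW e0; have d0' := ltW d0.
  rewrite -ler_sqr ?nnegrE ?nrm_ge0 ?addr_ge0//.
  have /Dle : V ((2^-1)%:C *: (v + w)) by apply: subspaceZ => //; exact: subspaceD.
  have -> : x - (2^-1)%:C *: (v + w) = (2^-1)%:C *: ((x - v) + (x - w)).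
    rewrite addrACA -opprD scalerBr.
    by rewrite half_double.
  rewrite nrmZr exprMn real_normK ?num_real// nrm_sqD.
  have -> : v - w = (x - w) - (x - v) by rewrite opprB [RHS]addrC addrA subrK.
  rewrite (nrm_sqB (x - w)) (rdotC (x - w)).
  have de : 0 <= e * d by rewrite mulr_ge0.
  by move: vF wF; lra.
have l_le e : 0 < e -> exists2 v, V v & nrm (l - v) <= e /\
    nrm (x - v) ^+ 2 < inf D + e ^+ 2 / 2.
  move=> e0.
  have [|_ [v Vv <-] vD] := @inf_adherent _ _ (e ^+ 2 / 2) _ D0.
    by rewrite divr_gt0 ?exprn_gt0.
  by exists v => //; split=> //; rewrite nrmBC; apply: lF => //; split.
have Vl : V l.
  apply: closed_approx => // e e0; have [|v Vv [lv _]] := l_le (e / 2); first lra.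
  by exists v => //; lra.
exists l => // w Vw; apply: inner0_le => a; set u := a *: w.
have Vu : V u by exact: subspaceZ.
(* the limit attains the infimum *)
have xl : nrm (x - l) ^+ 2 <= inf D.
  rewrite leNgt; apply/negP => lt.
  set c := nrm (x - l) in lt.
  have c0 : 0 <= c by exact: nrm_ge0.
  set g := c ^+ 2 - inf D.
  have g0 : 0 < g by rewrite /g; lra.
  pose e := Num.min 1 (g / (4 * (c + 1))).
  have e1 : e <= 1 by rewrite ge_min lexx.
  have e2 : e * (4 * (c + 1)) <= g.
    by rewrite -ler_pdivlMr; [rewrite ge_min lexx orbT|lra].
  have e0 : 0 < e by rewrite lt_min ltr01 divr_gt0//; lra.
  have [v Vv [lv xv]] := l_le e e0.
  have := nrm_tri v x l; rewrite (nrmBC v l) -/c => tri.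
  have n0 := nrm_ge0 (x - v).
  have : (c - e) ^+ 2 <= nrm (x - v) ^+ 2 \/ c < e.
    case: (lerP e c) => ec; [left|by right].
    by rewrite ler_sqr ?nnegrE//; lra.
  rewrite /g in e2 g0 *.
  have inf0 : 0 <= inf D by apply: lb_le_inf; [exact: D0.1|move=> _ [? _ <-]; exact: sqr_ge0].
  by case=> h; nra.
(* the distance to [l + t u] is least at [t = 0], so its linear term is null *)
have key t : 0 <= t -> 2 * t * rdot (x - l) u <= t ^+ 2 * nrm u ^+ 2.
  move=> t0.
  have /Dle : V (l + t%:C *: u) by apply: subspaceD => //; exact: subspaceZ.
  rewrite opprD addrA nrm_sqB rdotZr nrmZr exprMn real_normK ?num_real//.
  by lra.
rewrite leNgt; apply/negP => r0.
pose n := nrm u ^+ 2; have n0 : 0 <= n by exact: sqr_ge0.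
have := key (rdot (x - l) u / (n + 1)).
have q0 : 0 < rdot (x - l) u / (n + 1) by rewrite divr_gt0//; lra.
move=> /(_ (ltW q0)); rewrite -/n.
set r := rdot _ _ in r0 q0 *; set q := r / _ in q0 *.
have rE : r = q * (n + 1) by rewrite /q divfK//; lra.
rewrite rE leNgt => /negP; apply.
have q20 : 0 < q ^+ 2 by rewrite exprn_gt0.
by nra.
Qed.

Lemma orthK V x : closed_subspace V -> orth (orth V) x -> V x.
Proof.
move=> cV Vx; have [v Vv vx] := orth_projection x cV.
suff -> : x = v by [].
apply/eqP; rewrite -subr_eq0; apply/eqP; apply: (@orth_cap (orth V)) => //.
have [s _] := orth_closed_subspace (orth V).
by apply: (subspaceB s) => //; exact: subset_orth2.
Qed.

Lemma orth_orth_closure V : subspace V -> orth (orth V) = closure V.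
Proof.
move=> sV; rewrite -(orth_closure V); apply/seteqP; split; last exact: subset_orth2.
by move=> x; apply: orthK; exact: closure_subspace.
Qed.

End Subspaces.

(** * Bounded operators and adjoints *)

Section Operators.
Variables (R : realType) (H K : hilbertType R).
Implicit Types (A B : bounded_op H K).

Lemma bop_bound A : exists2 M : R, 0 < M & forall x, nrm (A x) <= M * nrm x.
Proof.
exists (opnorm A + 1); first by have := opnorm_ge0 A; lra.
move=> x; rewrite mulrDl mul1r ler_wpDr ?nrm_ge0//.
by rewrite -lecR rmorphM/= -!normE opnormP.
Qed.

Lemma opnorm_nrm A (e : R) : 0 <= e -> (forall x, nrm (A x) <= e * nrm x) ->
  opnorm A <= e.
Proof.
move=> e0 Ae; apply: opnorm_le => x; rewrite normE -[1]/(1%:C) lecR => x1.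
by rewrite normE lecR (le_trans (Ae x))// ler_piMr.
Qed.

Lemma bop_compE (G : hilbertType R) (B : bounded_op K G) A x : (B \oB A) x = B (A x).
Proof. by []. Qed.

Lemma bop0 A : A 0 = 0.
Proof. exact: linear0. Qed.
Lemma bopD A x y : A (x + y) = A x + A y.
Proof. exact: linearD. Qed.
Lemma bopB A x y : A (x - y) = A x - A y.
Proof. exact: linearB. Qed.
Lemma bopZ A a x : A (a *: x) = a *: A x.
Proof. exact: linearZ. Qed.

Lemma bopBE A B x : (A - B) x = A x - B x.
Proof. by []. Qed.
Lemma bopDE A B x : (A + B) x = A x + B x.
Proof. by []. Qed.
Lemma bopZE a A x : (a *: A) x = a *: A x.
Proof. by []. Qed.

(** Operators are built below from relations: single-valuedness follows from
the norm bound, applied to the difference of two values. *)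
Lemma bounded_op_of_graph (G : H -> K -> Prop) (M : R) :
  (forall x, exists y, G x y) ->
  (forall a x x' y y', G x y -> G x' y' -> G (a *: x + x') (a *: y + y')) ->
  (forall x y, G x y -> nrm y <= M * nrm x) ->
  exists T : bounded_op H K, forall x y, G x y <-> y = T x.
Proof.
move=> Gtot Glin Gbd.
have Gfun x y y' : G x y -> G x y' -> y = y'.
  move=> xy xy'; have := Glin (-1) _ _ _ _ xy' xy.
  rewrite !scaleN1r ![- _ + _]addrC subrr => /Gbd.
  by rewrite nrm0 mulr0 => /nrm_le0/eqP; rewrite subr_eq0 => /eqP.
pose f x := projT1 (cid (Gtot x)).
have Gf x : G x (f x) by rewrite /f; case: cid.
have fb : f \in @bounded_linear R H K.
  apply/bounded_linearP; split=> [a x y|]; first by apply: (Gfun (a *: x + y)) => //; exact: Glin.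
  by exists M => x; rewrite !normE -rmorphM lecR; exact: Gbd.
exists (BoundedOp fb) => x y; split=> [xy|->//]; exact: (Gfun x).
Qed.

Lemma preimage_closed_subspace A (V : set K) : closed_subspace V ->
  closed_subspace (A @^-1` V).
Proof.
move=> [/subspaceP[V0 VD] cV]; split.
  apply/subspaceP; split; first by rewrite /= linear0.
  by move=> a x y /= Vx Vy; rewrite linearP; exact: VD.
apply: closed_approxP => x h; apply: (closed_approx cV) => e e0.
have [M M0 AM] := bop_bound A.
have [|y Vy xy] := h (e / M); first by rewrite divr_gt0.
exists (A y) => //; rewrite -linearB (le_lt_trans (AM _))// mulrC.
by rewrite -ltr_pdivlMr.
Qed.

Lemma range_subspace A : subspace (range A).
Proof.
apply/subspaceP; split; first by exists 0; rewrite ?linear0.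
by move=> a _ _ [x _ <-] [y _ <-]; exists (a *: x + y) => //; rewrite linearP.
Qed.

(** Riesz representation of [x |-> '[A x, y]]: its kernel is a closed
hyperplane (or everything), and a normal vector to it, suitably scaled,
represents it. *)
Lemma riesz A y : exists z, forall x, '[A x, y] = '[x, z].
Proof.
pose V := A @^-1` (orth [set y]).
have VE x : V x <-> '[A x, y] = 0 by split=> [/(_ y erefl)//|h _ ->].
have cV : closed_subspace V.
  exact/preimage_closed_subspace/orth_closed_subspace.
have [h|/existsNP[x0 nx0]] := pselect (forall x, '[A x, y] = 0).
  by exists 0 => x; rewrite h inner0r.
have [v /VE Vv] := orth_projection x0 cV; set u := x0 - v => ou.
have ux0 : '[A u, y] = '[A x0, y] by rewrite linearB innerBl Vv subr0.
have u0 : '[u, u] != 0.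
  apply/eqP => /inner_eq0 u0; apply: nx0.
  by rewrite -ux0 u0 linear0 inner0l.
have a0 : '[A u, y] != 0 by rewrite ux0; exact/eqP.
exists (Num.conj ('[A u, y] / '[u, u]) *: u) => x.
rewrite innerZr conjCK.
have xu : '[x - ('[A x, y] / '[A u, y]) *: u, u] = 0.
  apply: inner0C; apply: ou; apply/VE.
  by rewrite linearB linearZ innerBl innerZl divfK ?subrr.
have -> : '[x, u] = '[A x, y] / '[A u, y] * '[u, u].
  by apply/eqP; rewrite -subr_eq0 -innerZl -innerBl xu.
field; by rewrite a0 u0.
Qed.

(** When [A] is bounded below on [X], approximate preimages of a limit of images
form a Cauchy family. *)
Lemma image_closed_subspace A (X : set H) (c : R) : closed_subspace X -> 0 < c ->
  (forall x, X x -> c * nrm x <= nrm (A x)) -> closed_subspace (A @` X).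
Proof.
move=> [/subspaceP[X0 XD] cX] c0 Xc.
have sX : subspace X by apply/subspaceP.
split.
  apply/subspaceP; split; first by exists 0; rewrite ?linear0.
  move=> a _ _ [x Xx <-] [y Xy <-]; exists (a *: x + y); first exact: XD.
  by rewrite linearP.
apply: closed_approxP => y h.
pose F e := [set x | X x /\ nrm (y - A x) < e * c].
have [||l lF] := @cauchy_family R H F.
- move=> e e0; have [|_ [x Xx <-] xy] := h (e * c); first by rewrite mulr_gt0.
  by exists x.
- move=> e d x x' e0 d0 [Xx xF] [Xx' xF'].
  have /Xc : X (x - x') by exact: subspaceB.
  rewrite linearB/= => h1; have h2 := nrm_tri y (A x) (A x').
  by rewrite (nrmBC (A x) y) in h2; rewrite -(ler_pM2l c0); lra.
exists l.
  apply: (closed_approx cX) => e e0.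
  have [|_ [x Xx <-] xy] := h (e / 2 * c); first by rewrite mulr_gt0//; lra.
  exists x => //; have := lF (e / 2) x ltac:(lra) (conj Xx xy).
  by rewrite nrmBC; lra.
apply/eqP; rewrite -subr_eq0; apply/eqP/nrm_le0/ler_addgt0Pr => e e0.
have [M M0 AM] := bop_bound A.
pose d := e / (M + c).
have d0 : 0 < d by rewrite divr_gt0//; lra.
have [|_ [x Xx <-] xy] := h (d * c); first by rewrite mulr_gt0.
have h3 := lF d x d0 (conj Xx xy).
have h1 := AM (l - x); rewrite linearB (nrmBC l) in h1.
have h2 := nrm_tri (A x) (A l) y; rewrite nrmBC in xy.
have : M * nrm (x - l) <= M * d by rewrite ler_wpM2l// ltW.
have -> : e = M * d + d * c by rewrite /d; field; lra.
lra.
Qed.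

End Operators.

Section AdjointTheory.
Variable R : realType.
Implicit Types H K G : hilbertType R.

Lemma adjoint_spec H K (A : bounded_op H K) : is_adjoint A (adjoint A).
Proof.
suff : exists B, is_adjoint A B by move=> [B AB]; exact: (xgetI 0 AB).
have [M M0 AM] := bop_bound A.
pose S y z := forall x, '[A x, y] = '[x, z].
have [|||B BS] := @bounded_op_of_graph R K H S M.
- exact: riesz.
- by move=> a y y' z z' yz y'z' x; rewrite !(innerDr, innerZr) yz y'z'.
- move=> y z /(_ z) yz.
  have [->|z0] := eqVneq z 0; first by rewrite nrm0 mulr_ge0 ?nrm_ge0// ltW.
  rewrite -nrm_gt0 in z0; rewrite -(ler_pM2l z0) -expr2 -rdotxx /rdot -yz.
  apply: (le_trans (cauchy_schwarz _ _)).
  by rewrite mulrCA mulrA ler_wpM2r ?nrm_ge0.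
exists B => x y; have /BS/(_ x) := erefl (B y); exact.
Qed.

Lemma adjointE H K (A : bounded_op H K) x y : '[A x, y] = '[x, adjoint A y].
Proof. exact: adjoint_spec. Qed.

Lemma adjointEl H K (A : bounded_op H K) x y : '[adjoint A y, x] = '[y, A x].
Proof. by rewrite innerC -adjointE -innerC. Qed.

Lemma inner_ext H (x y : H) : (forall z, '[x, z] = '[y, z]) -> x = y.
Proof.
move=> h; apply/eqP; rewrite -subr_eq0; apply/eqP/inner_eq0.
by rewrite innerBl h subrr.
Qed.

Lemma adjoint_eq H K (A : bounded_op H K) B : is_adjoint A B -> adjoint A = B.
Proof.
move=> AB; apply/bounded_op_eqP => y; apply: inner_ext => x.
by rewrite adjointEl innerC AB -innerC.
Qed.

Lemma adjointK H K (A : bounded_op H K) : adjoint (adjoint A) = A.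
Proof. by apply: adjoint_eq => x y; rewrite adjointEl. Qed.

Lemma adjoint_comp H K G (A : bounded_op H K) (B : bounded_op K G) :
  adjoint (B \oB A) = adjoint A \oB adjoint B.
Proof. by apply: adjoint_eq => x y; rewrite !bop_compE !adjointE. Qed.

Lemma adjointB H K (A B : bounded_op H K) : adjoint (A - B) = adjoint A - adjoint B.
Proof.
by apply: adjoint_eq => x y; rewrite !bopBE innerBl innerBr !adjointE.
Qed.

Lemma adjoint_bound H K (A : bounded_op H K) (e : R) : 0 <= e ->
  (forall x, nrm (A x) <= e * nrm x) -> forall y, nrm (adjoint A y) <= e * nrm y.
Proof.
move=> e0 Ae y; set z := adjoint A y.
have [->|z0] := eqVneq z 0; first by rewrite nrm0 mulr_ge0 ?nrm_ge0.
rewrite -nrm_gt0 in z0; rewrite -(ler_pM2l z0) -expr2 -rdotxx /rdot -adjointE.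
apply: (le_trans (cauchy_schwarz _ _)).
by rewrite mulrCA mulrA ler_wpM2r ?nrm_ge0.
Qed.

Lemma orth_range H K (A : bounded_op H K) : orth (range A) = adjoint A @^-1` [set 0].
Proof.
apply/seteqP; split=> y /=.
  by move=> oy; apply: inner_ext => x; rewrite inner0l adjointEl oy//; exists x.
by move=> y0 _ [x _ <-]; rewrite -adjointEl y0 inner0l.
Qed.

(** Polarisation, in a form that applies to pairs of vectors of different
spaces. *)
Lemma inner_polar H K (x y : H) (x' y' : K) :
  (forall a : R[i], nrm (x + a *: y) = nrm (x' + a *: y')) ->
  nrm x = nrm x' -> (forall a : R[i], nrm (a *: y) = nrm (a *: y')) ->
  '[x, y] = '[x', y'].
Proof.
move=> h hx hy.
have rE a : rdot x (a *: y) = rdot x' (a *: y').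
  have := congr1 (fun r => r ^+ 2) (h a); rewrite !nrm_sqD hx hy; lra.
exact: inner_eq_rdot.
Qed.

(** The hypothesis [A^* A = B^* B] is used below through norms and inner
products of values. *)
Lemma gram_eq H K (A B : bounded_op H K) :
  adjoint A \oB A = adjoint B \oB B <-> forall x, nrm (A x) = nrm (B x).
Proof.
split=> [AB x|AB].
  apply/eqP; rewrite -(@eqrXn2 _ 2)// ?nrm_ge0// -!rdotxx /rdot !adjointE.
  by rewrite -!bop_compE AB.
apply/bounded_op_eqP => x; apply: inner_ext => y.
rewrite !bop_compE !adjointEl.
have TZ (T : bounded_op H K) a : a *: T y = T (a *: y) by rewrite linearZ.
have TD (T : bounded_op H K) a : T x + a *: T y = T (x + a *: y).
  by rewrite TZ linearD.
by apply: inner_polar => // a; rewrite ?TD ?TZ AB.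
Qed.

Lemma gram_inner H K (A B : bounded_op H K) :
  adjoint A \oB A = adjoint B \oB B -> forall x y, '[A x, A y] = '[B x, B y].
Proof. by move=> AB x y; rewrite !adjointE -!bop_compE AB. Qed.

Lemma unitary_isometry H (U : bounded_op H H) : unitary_op U ->
  [/\ forall x, nrm (U x) = nrm x, forall x, adjoint U (U x) = x &
      forall x, U (adjoint U x) = x].
Proof.
move=> [UU UU']; have UK x : adjoint U (U x) = x by rewrite -bop_compE UU.
split=> // x; last by rewrite -bop_compE UU'.
apply/eqP; rewrite -(@eqrXn2 _ 2)// ?nrm_ge0// -!rdotxx /rdot.
by rewrite adjointE UK.
Qed.

Lemma unitary_onto H (U : bounded_op H H) :
  (forall x y, '[U x, U y] = '[x, y]) -> (forall y, exists x, U x = y) ->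
  unitary_op U.
Proof.
move=> Uiso Usurj.
have UK x : adjoint U (U x) = x.
  by apply: inner_ext => y; rewrite adjointEl.
split; apply/bounded_op_eqP => x; rewrite bop_compE //=.
by have [z <-] := Usurj x; rewrite UK.
Qed.

Lemma unitary_adjoint H (U : bounded_op H H) : unitary_op U -> unitary_op (adjoint U).
Proof. by move=> [UU UU']; split; rewrite adjointK. Qed.

(** The closure in operator norm, restated with pointwise bounds, which pass to
adjoints and compositions directly. *)
Lemma closure_orbitP H K (T : Type) (D : set T) (f : T -> bounded_op H K) B :
  closure [set f U | U in D] B <->
  forall e : R, 0 < e -> exists2 U, D U & forall x, nrm (B x - f U x) <= e * nrm x.
Proof.
rewrite nrm_closureP; split=> h e e0.
  have [_ [U DU <-] BU] := h e e0; exists U => // x.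
  have := opnormP (B - f U) x; rewrite !normE -rmorphM lecR => /le_trans; apply.
  by rewrite ler_wpM2r ?nrm_ge0// ltW.
have [|U DU BU] := h (e / 2); first lra.
exists (f U); first by exists U.
apply: (@le_lt_trans _ _ (e / 2)); last lra.
by apply: opnorm_nrm => //; lra.
Qed.

End AdjointTheory.

(** * Cardinal arithmetic *)

Section Cardinals.

(** Transversal form of the well-ordering of cardinals. A maximal set of
tuples, pairwise different in every coordinate, projects onto one of the
sets [X i]: otherwise a tuple of fresh coordinates could be added. That [X i]
then injects into every other one. *)
Lemma card_min (I T : Type) (i0 : I) (X : I -> set T) :
  exists i, forall j, X i #<= X j.
Proof.
pose P : set (set (I -> T)) := [set F | (forall f, F f -> forall i, X i (f i)) /\
  (forall f g, F f -> F g -> forall i, f i = g i -> f = g)].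
have [|F [[FX Fd] maxF]] := @Zorn_bigcup (I -> T) P.
  move=> C CP Ctot; split=> [f [F CF Ff]|f g [F CF Ff] [G CG Gg] i fg].
    exact: (CP F CF).1.
  have [FG|GF] := Ctot F G CF CG.
    exact: (CP G CG).2 (FG _ Ff) Gg i fg.
  exact: (CP F CF).2 Ff (GF _ Gg) i fg.
have [i Xi] : exists i, forall x, X i x -> exists2 f, F f & f i = x.
  apply: contrapT => /forallNP h.
  have h' i : exists x, X i x /\ forall f, F f -> f i <> x.
    have /existsNP[x /not_implyP[Xx nx]] := h i.
    by exists x; split=> // f Ff fx; apply: nx; exists f.
  pose g i := projT1 (cid (h' i)).
  have gP i : X i (g i) /\ forall f, F f -> f i <> g i.
    by rewrite /g; case: cid.
  apply: (maxF (g |` F)).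
    split; first by move=> f; right.
    by move=> /(_ g (or_introl erefl)) Fg; have [_ /(_ g Fg)] := gP i0.
  split=> [f [->|/FX//] i|f f' [->|Ff] [->|Ff'] i //]; first exact: (gP i).1.
  - by move=> e; have [_ /(_ f' Ff')] := gP i; rewrite e.
  - by move=> e; have [_ /(_ f Ff)] := gP i; rewrite e.
  - exact: Fd.
exists i => j.
apply: (@card_le_trans _ _ _ F).
  have -> : X i = (fun f => f i) @` F.
    apply/seteqP; split=> [x /Xi[f Ff <-]|_ [f Ff <-]]; first by exists f.
    exact: FX.
  exact: card_image_le.
apply: (@card_le_trans _ _ _ ((fun f => f j) @` F)).
  have : (fun f => f j) @` F #= F.
    by apply: inj_card_eq => f g; rewrite !in_setE => Ff Fg; exact: Fd.
  by rewrite card_eq_le => /andP[].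
apply: subset_card_le => _ [f Ff <-]; exact: FX.
Qed.

Lemma card_le_inj (T : Type) (U : pointedType) (A : set T) (B : set U) :
  A #<= B <-> exists f : T -> U, (forall x, A x -> B (f x)) /\
    forall x y, A x -> A y -> f x = f y -> x = y.
Proof.
split=> [/pcard_leP/injfunPex[f fAB fi]|[f [fAB fi]]].
  by exists f; split=> // x y Ax Ay; apply: fi; rewrite in_setE.
apply/pcard_leP/injfunPex; exists f => // x y; rewrite !in_setE; exact: fi.
Qed.

(** An infinite set is partitioned into countably infinite pieces: a maximal
disjoint family of such pieces leaves only finitely many points over, which
can be absorbed by any one piece. *)
Lemma infinite_card_mul_nat (T : pointedType) (X : set T) : infinite_set X ->
  X `*` [set: nat] #<= X.
Proof.
move=> Xinf.
pose P : set (set (set T)) := [set F |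
  (forall D, F D -> [/\ D `<=` X, countable D & infinite_set D]) /\
  (forall D E, F D -> F E -> forall x, D x -> E x -> D = E)].
have [|F [[FX Fd] maxF]] := @Zorn_bigcup (set T) P.
  move=> C CP Ctot; split=> [D [F CF FD]|D E [F CF FD] [G CG GE] x Dx Ex].
    exact: (CP F CF).1.
  have [FG|GF] := Ctot F G CF CG.
    exact: (CP G CG).2 (FG _ FD) GE x Dx Ex.
  exact: (CP F CF).2 FD (GF _ GE) x Dx Ex.
pose L := X `\` \bigcup_(D in F) D.
have Lfin : finite_set L.
  apply: contrapT => /infiniteP/card_le_inj[f [fL finj]].
  have fI : infinite_set (range f).
    apply/infiniteP/card_le_inj; exists f; split=> // x _; by exists x.
  apply: (maxF (range f |` F)).
    split; first by move=> D; right.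
    move=> /(_ (range f) (or_introl erefl)) FD.
    by have [_ /= []] := fL 0%N I; exists (range f) => //; exists 0%N.
  split=> [D [->|/FX//]|D E [->|FD] [->|FE] x //].
  - split=> // [_ [n _ <-]|]; first by have [] := fL n I.
    apply: card_le_trans (card_image_le _ _) _; exact: card_lexx.
  - by move=> [n _ <-] En; have [_ []] := fL n I; exists E.
  - by move=> Dn [n _ xE]; move: Dn; rewrite -xE => Dn; have [_ []] := fL n I; exists D.
  - exact: Fd.
have [D0 FD0] : F !=set0.
  apply/set0P/eqP => F0; apply: Xinf; move: Lfin.
  by rewrite /L F0 bigcup_set0 setD0.
pose F' D := (F D /\ D <> D0) \/ D = D0 `|` L.
have F'c D : F' D -> D `*` [set: nat] #<= D.
  move=> F'D; have [cD iD] : countable D /\ infinite_set D.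
    case: F'D => [[/FX[]]//|->]; have [_ c0 i0] := FX _ FD0; split.
      rewrite -bigcup2E; apply: bigcup_countable => // -[|[|n]] _ //=.
      exact: finite_set_countable.
    by move=> /sub_finite_set h; apply: i0; apply: h => x; left.
  apply: (@card_le_trans _ _ _ [set: nat]); last exact/infiniteP.
  by apply: countableX => //; exact: countableP.
have F'd D E x : F' D -> F' E -> D x -> E x -> D = E.
  case=> [[FD nD]|->] [[FE nE]|->] //.
  - by move=> Dx Ex; exact: Fd Dx Ex.
  - move=> Dx [Ex|[_ []]]; last by exists D.
    by have := Fd _ _ FD FD0 x Dx Ex.
  - move=> + Ex; case=> [Dx|[_ []]]; last by exists E.
    by have := Fd _ _ FE FD0 x Ex Dx.
have F'X x : exists D, X x -> F' D /\ D x.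
  have [[D FD Dx]|nF] := pselect ((\bigcup_(D in F) D) x).
    have [DE|nD] := pselect (D = D0); last by exists D => _; split=> //; left.
    by exists (D0 `|` L) => _; split; [right|left; rewrite -DE].
  by exists (D0 `|` L) => Xx; split; [right|right].
pose p x := projT1 (cid (F'X x)).
have pP x : X x -> F' (p x) /\ p x x by rewrite /p; case: cid.
have F'g D : exists f : T * nat -> T, F' D -> (forall x, (D `*` setT) x -> D (f x)) /\
    forall x y, (D `*` setT) x -> (D `*` setT) y -> f x = f y -> x = y.
  have [/F'c/card_le_inj[f fP]|nF] := pselect (F' D); first by exists f.
  by exists fst.
pose g D := projT1 (cid (F'g D)).
have gP D : F' D -> (forall x, (D `*` setT) x -> D (g D x)) /\
    forall x y, (D `*` setT) x -> (D `*` setT) y -> g D x = g D y -> x = y.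
  by rewrite /g; case: cid.
have F'sub D : F' D -> D `<=` X.
  case=> [[/FX[]]//|-> x [|[]//]]; by have [+ _ _] := FX _ FD0; apply.
apply/card_le_inj; exists (fun x => g (p x.1) x); split=> [[x n] [/= Xx _]|].
  have [F'p px] := pP _ Xx; apply: (F'sub (p x)) => //.
  by apply: (gP _ F'p).1.
move=> [x n] [y m] [/= Xx _] [/= Xy _] e.
have [F'px px] := pP _ Xx; have [F'py py] := pP _ Xy.
have pxy : p x = p y.
  apply: (F'd _ _ (g (p x) (x, n))) => //; first exact: (gP _ F'px).1.
  by rewrite e; exact: (gP _ F'py).1.
by apply: (gP _ F'px).2 => //; [rewrite pxy|rewrite e pxy].
Qed.

(** Infinitely many countable sets have a union no larger than their index set;
this bounds one orthonormal basis by another. *)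
Lemma card_le_countable_fibers (T U : pointedType) (A : set T) (B : set U)
    (C : U -> set T) : infinite_set B -> (forall b, countable (C b)) ->
  A `<=` \bigcup_(b in B) C b -> A #<= B.
Proof.
move=> Binf Cc AC; apply: (card_le_trans _ (infinite_card_mul_nat Binf)).
have h a : exists b, A a -> B b /\ C b a.
  have [/AC[b Bb Cb]|] := pselect (A a); first by exists b.
  by exists point.
pose f a := projT1 (cid (h a)).
have fP a : A a -> B (f a) /\ C (f a) a by rewrite /f; case: cid.
have k b : exists g : T -> nat, forall x y, C b x -> C b y -> g x = g y -> x = y.
  have /countable_injP[g gi] := Cc b; exists g => x y Cx Cy.
  by apply: gi; rewrite in_setE.
pose g b := projT1 (cid (k b)).
have gP b x y : C b x -> C b y -> g b x = g b y -> x = y.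
  by rewrite /g; case: cid => ? /= + ? ?; apply.
apply/card_le_inj; exists (fun a => (f a, g (f a) a)); split.
  by move=> a Aa; split=> //=; have [] := fP a Aa.
move=> x y /fP[_ Cx] /fP[_ Cy] [fxy]; rewrite fxy in Cx *; exact: gP.
Qed.

HB.instance Definition _ (T U : pointedType) :=
  isPointed.Build (T + U)%type (inl point).

Lemma card_sum_le (T T' U U' : pointedType) (A : set T) (A' : set T')
    (B : set U) (B' : set U') :
  A #<= A' -> B #<= B' -> card_sum A B #<= card_sum A' B'.
Proof.
move=> /card_le_inj[f [fA fi]] /card_le_inj[g [gB gi]].
apply/card_le_inj.
exists (fun x => match x with inl a => inl (f a) | inr b => inr (g b) end).
split=> [_ [[a Aa <-]|[b Bb <-]]|_ _ [[a Aa <-]|[b Bb <-]] [[a' Aa' <-]|[b' Bb' <-]]] //.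
- by left; exists (f a) => //; exact: fA.
- by right; exists (g b) => //; exact: gB.
- by move=> [/fi ->].
- by move=> [/gi ->].
Qed.

Lemma card_sum_eq (T T' U U' : pointedType) (A : set T) (A' : set T')
    (B : set U) (B' : set U') :
  A #= A' -> B #= B' -> card_sum A B #= card_sum A' B'.
Proof.
rewrite !card_eq_le => /andP[? ?] /andP[? ?].
by apply/andP; split; exact: card_sum_le.
Qed.

Lemma card_setU_sum (T : pointedType) (A B : set T) :
  A `&` B = set0 -> A `|` B #= card_sum A B.
Proof.
move=> AB; have AB' x : A x -> B x -> False.
  by move=> Ax Bx; have : (A `&` B) x by []; rewrite AB.
pose h (x : T + T) := match x with inl a => a | inr b => b end.
rewrite card_eq_sym; apply/card_esym.
have <- : h @` card_sum A B = A `|` B.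
  apply/seteqP; split=> [_ [_ [[a Aa <-]|[b Bb <-]] <-]|x [Ax|Bx]]; [by left|by right| |].
  - by exists (inl x) => //; left; exists x.
  - by exists (inr x) => //; right; exists x.
apply: inj_card_eq => x y; rewrite !in_setE.
move=> [[a Aa <-]|[b Bb <-]] [[a' Aa' <-]|[b' Bb' <-]] /= e.
- by rewrite e.
- by case: (AB' a) => //; rewrite e.
- by case: (AB' b) => //; rewrite e.
- by rewrite e.
Qed.

End Cardinals.

(** * Hilbert dimension *)

Section Dimension.
Variable R : realType.
Implicit Types H K : hilbertType R.

Lemma lspan_subspace H (S : set H) : subspace (lspan S).
Proof.
apply/subspaceP; split; first by move=> V [sV _]; exact: subspace0.
move=> a x y Sx Sy V VS; have [/subspaceP[_ VD] _] := VS.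
by apply: VD; [exact: Sx|exact: Sy].
Qed.

Lemma sub_lspan H (S : set H) : S `<=` lspan S.
Proof. by move=> x Sx V [_]; exact. Qed.

Lemma lspan_min H (S V : set H) : subspace V -> S `<=` V -> lspan S `<=` V.
Proof. by move=> sV SV x; apply. Qed.

Lemma orth_lspan H (S : set H) : orth (lspan S) = orth S.
Proof.
apply/seteqP; split; first by apply: subset_orth; exact: sub_lspan.
move=> x Sx y Sy; have [so _] := orth_closed_subspace [set x].
apply: inner0C; suff : orth [set x] y by apply.
apply: lspan_min Sy => // z Sz _ ->; exact: orth_sym Sz _.
Qed.

Lemma orth_closure_lspan H (S : set H) : orth (closure (lspan S)) = orth S.
Proof. by rewrite orth_closure orth_lspan. Qed.

(** In a closed subspace, density of the span amounts to maximality: what the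
projection onto the closed span leaves over stays in the subspace. *)
Lemma orthonormal_basisP H (V S : set H) : closed_subspace V ->
  orthonormal_basis V S <->
  [/\ S `<=` V, orthonormal_set S & forall x, V x -> orth S x -> x = 0].
Proof.
move=> cV; have cS := closure_subspace (lspan_subspace S).
split=> [[SV oS VS]|[SV oS VS]]; split=> // x Vx.
  by rewrite -orth_closure_lspan; apply: orth_cap; exact: VS.
have [v Sv] := orth_projection x cS; rewrite orth_closure_lspan => ov.
suff /eqP : x - v = 0 by rewrite subr_eq0 => /eqP ->.
apply: VS => //; apply: (subspaceB cV.1) => //.
rewrite -(closure_closed_subspace cV); apply: closure_subset Sv.
by apply: lspan_min => //; exact: cV.1.
Qed.

Lemma orth_onb H (V S : set H) : closed_subspace V -> orthonormal_basis V S ->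
  orth S = orth V.
Proof.
move=> cV [SV _ VS]; apply/seteqP; split; last exact: subset_orth.
by rewrite -orth_closure_lspan; exact: subset_orth.
Qed.

Lemma orthonormal_neq0 H (S : set H) e : orthonormal_set S -> S e -> e <> 0.
Proof.
move=> oS Se e0; have := oS _ _ Se Se; rewrite eqxx e0 inner0l => /eqP.
by rewrite eq_sym oner_eq0.
Qed.

Lemma onb_exists H (V : set H) : closed_subspace V ->
  exists S, orthonormal_basis V S.
Proof.
move=> cV; pose P : set (set H) := [set S | S `<=` V /\ orthonormal_set S].
have [|S [[SV oS] maxS]] := @Zorn_bigcup H P.
  move=> C CP Ctot; split=> [x [S CS Sx]|x y [S CS Sx] [S' CS' Sy]].
    exact: (CP S CS).1.
  have [SS'|S'S] := Ctot S S' CS CS'.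
    exact: (CP S' CS').2 (SS' _ Sx) Sy.
  exact: (CP S CS).2 Sx (S'S _ Sy).
exists S; apply/orthonormal_basisP => //; split=> // x Vx Sx.
apply: contrapT => /eqP; rewrite -nrm_gt0 => x0.
pose e := ((nrm x)^-1)%:C *: x.
have ee : '[e, e] = 1.
  rewrite inner_nrm nrmZr gtr0_norm ?invr_gt0// mulVf ?gt_eqF//.
  by rewrite expr1n.
have Se y : S y -> '[e, y] = 0 by move=> Sy; rewrite innerZl Sx// mulr0.
apply: (maxS (e |` S)).
  split; first by move=> y; right.
  move=> /(_ e (or_introl erefl)) /Se; rewrite ee => /eqP; rewrite oner_eq0//.
split=> [y [->|/SV//]|y z [->|Sy] [->|Sz]].
- by apply: subspaceZ => //; exact: cV.1.
- by rewrite ee eqxx.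
- rewrite Se//; case: eqP => // ez.
  by have := Se z Sz; rewrite -ez ee => /eqP; rewrite oner_eq0.
- rewrite inner0C ?Se//; case: eqP => // ez.
  by have := Se y Sy; rewrite ez ee => /eqP; rewrite oner_eq0.
- exact: oS.
Qed.

Lemma hdim_onb H (V : set H) : closed_subspace V -> orthonormal_basis V (hdim V).
Proof. by move=> /onb_exists[S VS]; exact: xgetI VS. Qed.

(** A vector of the algebraic span of [S] is orthogonal to all but finitely
many elements of [S], so a limit of such vectors to all but countably many. *)
Lemma countable_coefficients H (S : set H) (z : H) : orthonormal_set S ->
  countable [set e | S e /\ '[z, e] != 0].
Proof.
move=> oS; have cS := closure_subspace (lspan_subspace S).
have [p Sp op] := orth_projection z cS; rewrite orth_closure_lspan in op.
pose Q : set H := [set y | exists2 F : set H, finite_set F &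
  forall e, S e -> ~ F e -> '[y, e] = 0].
have SQ : lspan S `<=` Q.
  apply: lspan_min; last first.
    move=> e0 Se0; exists [set e0]; first exact: finite_set1.
    by move=> e Se ne; rewrite oS//; case: eqP => // ee; case: ne; rewrite ee.
  apply/subspaceP; split=> [|a x y [F Ff Fx] [G Gf Gy]].
    by exists set0 => // e _ _; rewrite inner0l.
  exists (F `|` G); first by rewrite finite_setU.
  move=> e Se nFG; rewrite innerDl innerZl Fx ?Gy ?mulr0 ?addr0//.
    by move=> ?; apply: nFG; right.
  by move=> ?; apply: nFG; left.
have hF n : exists2 F : set H, finite_set F & forall e a, S e -> ~ F e ->
    rdot p (a *: e) <= n.+1%:R^-1 * nrm (a *: e).
  have [|y /SQ[F Ff Fy] py] := (nrm_closureP _ _).1 Sp (n.+1%:R^-1).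
    by rewrite invr_gt0.
  exists F => // e a Se Fe.
  have -> : rdot p (a *: e) = rdot (p - y) (a *: e).
    by rewrite rdotBl [X in _ - X]rdot0 ?subr0// innerZr Fy// mulr0.
  apply: (le_trans (cauchy_schwarz _ _)); rewrite ler_wpM2r ?nrm_ge0//.
  exact: ltW.
pose F n := projT1 (cid2 (hF n)).
have Ff n : finite_set (F n) by rewrite /F; case: cid2.
have FP n e a : S e -> ~ F n e -> rdot p (a *: e) <= n.+1%:R^-1 * nrm (a *: e).
  by rewrite /F; case: cid2 => G /= _ + ? ?; apply.
apply: (@sub_countable _ _ _ (\bigcup_(n in [set: nat]) F n)); last first.
  by apply: bigcup_countable => // n _; exact: finite_set_countable.
apply: subset_card_le => e [Se ze]; apply: contrapT => nF.
move/eqP: ze; apply; rewrite -(subrK p z) innerDl op// add0r.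
apply: inner0_le => a; apply/ler_addgt0Pr => d d0; rewrite add0r.
set N := nrm (a *: e); have N0 : 0 <= N by exact: nrm_ge0.
have q0 : 0 < (N + 1) / d by rewrite divr_gt0//; lra.
have := archi_boundP (ltW q0); set n := Num.bound _ => nN.
have Fn : ~ F n e by move=> Fne; apply: nF; exists n.
apply: (le_trans (FP n e a Se Fn)); rewrite -/N mulrC ler_pdivrMr ?ltr0Sn//.
rewrite ltr_pdivrMr// in nN; rewrite -natr1 mulrDr mulr1 [d * _]mulrC; lra.
Qed.

(** With more basis vectors in [V] than in [W], the rectangular matrix of [T]
has a nonzero kernel vector, whose combination contradicts injectivity. *)
Lemma finite_dim_le H K (V S : set H) (W S' : set K) (T : bounded_op H K) :
  closed_subspace V -> closed_subspace W ->
  orthonormal_basis V S -> orthonormal_basis W S' ->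
  (forall x, V x -> orth W (T x) -> x = 0) -> finite_set S' -> S #<= S'.
Proof.
move=> cV cW oS oS' VW /finite_setP[n Sn].
have [SV oSS _] := oS.
apply: contrapT => nSS'.
have SI : `I_n.+1 #<= S.
  have [/finite_setP[m Sm]|/infiniteP Sinf] := pselect (finite_set S); last first.
    by apply: (card_le_trans _ Sinf); exact: card_leT.
  have [mn|nm] := leqP m n.
    case: nSS'; rewrite (card_le_eql Sm) (card_le_eqr Sn).
    by rewrite card_le_II.
  by rewrite (card_le_eqr Sm) card_le_II.
have [e [eS einj]] := (card_le_inj _ _).1 SI.
have [s [sS' _ sonto]] : exists s, set_bij `I_n S' s.
  by apply/card_set_bijP; rewrite card_eq_sym.
pose M : 'M[R[i]]_(n.+1, n) := \matrix_(i, j) '[T (e i), s j].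
have : kermx M != 0.
  rewrite kermx_eq0 /row_free; apply/negP => /eqP rM.
  by have := rank_leq_col M; rewrite rM ltnn.
move=> /rowV0Pn[c /sub_kermxP cM c0].
pose x := \sum_(i < n.+1) c 0 i *: e i.
have x0 : x = 0.
  apply: VW.
    rewrite /x; apply: big_ind => [|y z|i _].
    - exact: subspace0 cV.1.
    - exact: subspaceD cV.1.
    - by apply: subspaceZ cV.1 _; apply: SV; apply: eS => /=.
  rewrite -(orth_onb cW oS') => y /sonto[j jn <-].
  have := congr1 (fun A : 'rV_n => A 0 (Ordinal jn)) cM.
  rewrite !mxE => cMj; have -> : T x = \sum_(i < n.+1) c 0 i *: T (e i).
    by rewrite linear_sum; apply: eq_bigr => i _; rewrite linearZ.
  rewrite inner_suml -[RHS]cMj.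
  by apply: eq_bigr => i _; rewrite mxE innerZl.
move/eqP: c0; apply; apply/rowP => k; rewrite mxE.
have : '[x, e k] = 0 by rewrite x0 inner0l.
rewrite /x inner_suml (bigD1 k)//= innerZl oSS ?eqxx ?mulr1; last 2 first.
- by apply: eS => /=.
- by apply: eS => /=.
rewrite big1 ?addr0// => i ik; rewrite innerZl oSS; last 2 first.
- by apply: eS => /=.
- by apply: eS => /=.
case: eqP => [eik|]; last by rewrite mulr0.
move/eqP: ik; case; apply: val_inj.
by apply: (einj i k) => //=.
Qed.

(** The comparison principle for Hilbert dimensions: [V] is not larger than
[W] as soon as the compression of some bounded operator from [V] to [W] is
injective. For infinite [W], each basis vector of [W] is seen by countably
many basis vectors of [V], and each of the latter sees at least one. *)
Lemma onb_le H K (V S : set H) (W S' : set K) (T : bounded_op H K) :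
  closed_subspace V -> closed_subspace W ->
  orthonormal_basis V S -> orthonormal_basis W S' ->
  (forall x, V x -> orth W (T x) -> x = 0) -> S #<= S'.
Proof.
move=> cV cW oS oS' VW.
have [Sfin|Sinf] := pselect (finite_set S').
  exact: (finite_dim_le cV cW oS oS' VW).
have [SV oSS _] := oS.
apply: (@card_le_countable_fibers _ _ _ _
    (fun s => [set e | S e /\ '[adjoint T s, e] != 0])) => // [s|e Se].
  exact: countable_coefficients.
apply: contrapT => nS'; apply: (orthonormal_neq0 oSS Se); apply: VW; first exact: SV.
rewrite -(orth_onb cW oS') => s Ss; apply: contrapT => ns.
apply: nS'; exists s => //; split=> //; apply/eqP.
by rewrite adjointEl => /inner0C.
Qed.

Lemma hdim_le H K (V : set H) (W : set K) (T : bounded_op H K) :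
  closed_subspace V -> closed_subspace W ->
  (forall x, V x -> orth W (T x) -> x = 0) -> hdim V #<= hdim W.
Proof. by move=> cV cW; apply: onb_le => //; exact: hdim_onb. Qed.

Lemma onb_hdim H (V S : set H) : closed_subspace V -> orthonormal_basis V S ->
  hdim V #= S.
Proof.
move=> cV oS; have oV := hdim_onb cV.
have VV x : V x -> orth V (@bounded_id R H x) -> x = 0 by exact: orth_cap.
by rewrite card_eq_le; apply/andP; split; exact: onb_le VV.
Qed.

Lemma hdim_cap0 H (V W : set H) : closed_subspace V -> closed_subspace W ->
  (forall x, V x -> orth W x -> x = 0) -> hdim V #<= hdim W.
Proof. by move=> cV cW VW; exact: (hdim_le (T := @bounded_id R H)). Qed.

(** Bases of the complement of [E] and of the part of [E] orthogonal to [V]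
together form a basis of the complement of [V]. *)
Lemma hdim_orth_sum H (V E : set H) : closed_subspace V -> closed_subspace E ->
  V `<=` E -> hdim (orth V) #= card_sum (hdim (orth E)) (hdim (ominus E V)).
Proof.
move=> cV cE VE.
have coV := orth_closed_subspace V; have coE := orth_closed_subspace E.
have cm := ominus_closed_subspace V cE.
have o1 := hdim_onb coE; have o2 := hdim_onb cm.
have [s1 n1 _] := o1; have [s2 n2 _] := o2.
have h12 x y : hdim (orth E) x -> hdim (ominus E V) y -> '[x, y] = 0.
  by move=> /s1 Ex /s2[Ey _]; rewrite Ex.
have dj x : hdim (orth E) x -> hdim (ominus E V) x -> False.
  by move=> x1 x2; apply: (orthonormal_neq0 n1 x1); apply/inner_eq0/h12.
apply: (@card_eq_trans _ _ _ _ (hdim (orth E) `|` hdim (ominus E V))); last first.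
  apply: card_setU_sum; rewrite -subset0 => x [x1 x2]; exact: dj x1 x2.
apply: onb_hdim => //; apply/orthonormal_basisP => //; split.
- by move=> x [/s1|/s2[]//]; exact: subset_orth.
- move=> x y [x1|x2] [y1|y2]; [exact: n1| | |exact: n2].
    rewrite h12//; case: eqP => // xy; case: (dj x) => //; by rewrite xy.
  rewrite inner0C ?h12//; case: eqP => // xy; case: (dj x) => //; by rewrite xy.
- move=> x Vx ox.
  have /(orthK cE) Ex : orth (orth E) x.
    by rewrite -(orth_onb coE o1) => y y1; apply: ox; left.
  apply: (@orth_cap _ _ (ominus E V)); first by split.
  by rewrite -(orth_onb cm o2) => y y2; apply: ox; right.
Qed.

(** In a Hilbert space, complete and closed subspaces are the same. *)
Lemma complete_subspace_ofP H (E V : set H) : complete_subspace_of E V <->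
  V `<=` E /\ closed_subspace V.
Proof.
split=> [[VE sV cV]|[VE [sV cV]]]; split=> //.
  split=> // x Vx.
  have PF : ProperFilter (within V (nbhs x)).
    split; last exact: within_filter.
    by move=> /Vx[y [Vy]]; apply.
  have [||y Vy Fy] := cV _ PF.
  - by rewrite /within/=; near=> y.
  - by apply: cvg_cauchy; apply/cvg_ex; exists x; exact: cvg_within.
  have <- : y = x by apply: (cvg_unique (@norm_hausdorff _ H) Fy); exact: cvg_within.
  exact: Vy.
move=> F PF FV /cauchy_cvgP/cvg_ex[x Fx]; exists x => //.
by apply: (closed_cvg V cV _ _ Fx); exact: FV.
Unshelve. all: by end_near. Qed.

(** Since cardinals are well ordered, the class in the definition of [IC] is not
empty, and [IC] is a member of it. *)
Lemma IC_spec H (E : set H) : subspace E ->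
  (exists V, [/\ V `<=` E, closed_subspace V & IC E = hdim (ominus (closure E) V)])
  /\ forall V, V `<=` E -> closed_subspace V ->
       IC E #<= hdim (ominus (closure E) V).
Proof.
move=> sE.
pose codims := [set hdim (ominus (closure E) V) | V in complete_subspace_of E].
have c0 : complete_subspace_of E [set 0].
  apply/complete_subspace_ofP; split; first by move=> _ ->; exact: subspace0.
  exact: closed_subspace0.
pose I := {V : set H | `[< complete_subspace_of E V >]}.
pose i0 : I := exist _ [set 0] (asboolT c0).
have [i imin] := card_min i0 (fun i : I => hdim (ominus (closure E) (sval i))).
have [[V cV VE] Vmin] : codims (IC E) /\ forall d, codims d -> IC E #<= d.
  pose P := [set c | codims c /\ forall d, codims d -> c #<= d].
  have : P (hdim (ominus (closure E) (sval i))).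
    split; first by exists (sval i) => //; exact/asboolP/(svalP i).
    by move=> _ [V cV <-]; exact: imin (exist _ V (asboolT cV)).
  by move=> /(@xgetI _ set0 P).
split; first by exists V; have [? ?] := (complete_subspace_ofP _ _).1 cV; split.
by move=> W WE cW; apply: Vmin; exists W => //; apply/complete_subspace_ofP.
Qed.

End Dimension.

(** * Uniform boundedness and preimages of controlled norm *)

Section OpenMapping.
Variable R : realType.
Implicit Types H K : hilbertType R.

Lemma inv_pow3_small (e : R) : 0 < e -> exists n : nat, (3^-1 : R) ^+ n * (3 / 2) <= e.
Proof.
move=> e0; have q0 : 0 <= 3 / 2 / e by rewrite divr_ge0//; lra.
exists (Num.bound (3 / 2 / e)).
have := archi_boundP q0; set n := Num.bound _; rewrite ltr_pdivrMr// => h.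
rewrite mulrC exprVn ler_pdivrMr ?exprn_gt0//.
apply: (le_trans (ltW h)); rewrite mulrC ler_wpM2l ?(ltW e0)//.
by rewrite -natrX ler_nat ltnW// ltn_expl.
Qed.

(** A gliding hump: if [B] contains vectors [w n] of norm above [n 3^n], a
series with steps of length [3^-n], each along [w n] with the sign that does not
decrease the pairing, converges to a point whose pairing with [w n] is at least
[n / 2] in absolute value, since the later steps undo at most half of step
[n]. *)
Lemma uniform_boundedness H (B : set H) :
  (forall z, exists M : R, forall w, B w -> rdot z w <= M) ->
  exists2 C : R, 0 < C & forall w, B w -> nrm w <= C.
Proof.
move=> Bpt; apply: contrapT => nB.
have /choice[w wP] (n : nat) : exists w, B w /\ n%:R * 3 ^+ n < nrm w.
  apply: contrapT => h; apply: nB; exists (n%:R * 3 ^+ n + 1).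
    by rewrite ltr_wpDl ?mulr_ge0 ?ler0n ?exprn_ge0.
  move=> w Bw; rewrite leNgt; apply/negP => lt; apply: h; exists w; split=> //.
  by apply: lt_trans lt; rewrite ltrDl.
have w0 n : 0 < nrm (w n).
  have [_] := wP n; apply: le_lt_trans.
  by rewrite mulr_ge0 ?ler0n ?exprn_ge0.
pose t : R := 3^-1.
have t0 : 0 < t by rewrite invr_gt0.
pose h n := (t ^+ n / nrm (w n))%:C *: w n.
have hn n : nrm (h n) = t ^+ n.
  rewrite nrmZr ger0_norm ?divr_ge0 ?nrm_ge0 ?exprn_ge0 ?(ltW t0)//.
  by rewrite divfK// gt_eqF.
have hw n : rdot (h n) (w n) = t ^+ n * nrm (w n).
  by rewrite rdotZl rdotxx expr2 mulrA divfK// gt_eqF.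
pose step n x := if 0 <= rdot x (w n) then x + h n else x - h n.
pose x := fix x n := if n is n'.+1 then step n' (x n') else 0.
have xS n : nrm (x n - x n.+1) <= t ^+ n.
  by rewrite /= /step; case: ifP => _;
    rewrite opprD ?opprK addrA subrr ?sub0r ?add0r ?nrmN hn.
have xw n : t ^+ n * nrm (w n) <= `|rdot (x n.+1) (w n)|.
  have tw : 0 <= t ^+ n * nrm (w n) by rewrite mulr_ge0 ?nrm_ge0 ?exprn_ge0 ?(ltW t0).
  rewrite /= /step; case: (lerP 0 (rdot (x n) (w n))) => r.
    by rewrite rdotDl hw; apply: le_trans (ler_norm _); lra.
  by rewrite rdotBl hw -normrN; apply: le_trans (ler_norm _); lra.
have xnk n k : nrm (x n - x (n + k)%N) <= (t ^+ n - t ^+ (n + k)) * (3 / 2).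
  elim: k => [|k IH]; first by rewrite addn0 !subrr nrm0 mul0r.
  apply: (le_trans (nrm_tri (x (n + k)%N) _ _)); rewrite addnS.
  have := xS (n + k)%N; rewrite exprS /t.
  by move: IH; rewrite /t; lra.
have xnm n m : nrm (x n - x m) <= t ^+ n * (3 / 2) + t ^+ m * (3 / 2).
  wlog nm : n m / (n <= m)%N.
    move=> W; have [/W//|/ltnW/W mn] := leqP n m.
    by rewrite nrmBC [leRHS]addrC.
  have := xnk n (m - n)%N; rewrite subnKC//.
  have : 0 <= t ^+ m by rewrite exprn_ge0// ltW.
  lra.
pose F e := [set y | exists n, y = x n /\ t ^+ n * (3 / 2) <= e].
have [||l lF] := @cauchy_family R H F.
- by move=> e /inv_pow3_small[n en]; exists (x n), n.
- move=> e d _ _ e0 d0 [n [-> ne]] [m [-> md]].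
  by apply: (le_trans (xnm n m)); exact: lerD.
have xl n : nrm (x n - l) <= t ^+ n * (3 / 2).
  by apply: lF; [rewrite mulr_gt0 ?exprn_gt0//; lra|exists n].
have [M MP] := Bpt l; have [M' MP'] := Bpt (- l).
pose n := Num.bound (2 * (`|M| + `|M'|)).
have nM : 2 * (`|M| + `|M'|) < n%:R.
  by apply: archi_boundP; rewrite mulr_ge0 ?addr_ge0.
have [Bw wn] := wP n.
have h1 := MP _ Bw; have := MP' _ Bw; rewrite /rdot innerNl raddfN/= -/(rdot _ _) => h2.
have h3 := xw n.
have h4 : `|rdot (x n.+1) (w n)| <= `|rdot l (w n)| + t ^+ n / 2 * nrm (w n).
  have -> : x n.+1 = (x n.+1 - l) + l by rewrite subrK.
  rewrite rdotDl addrC (le_trans (ler_normD _ _))// lerD2l.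
  have c : nrm (x n.+1 - l) * nrm (w n) <= t ^+ n / 2 * nrm (w n).
    rewrite ler_wpM2r ?nrm_ge0//; apply: (le_trans (xl _)).
    by rewrite exprS /t; lra.
  rewrite ler_norml; apply/andP; split; last exact: le_trans (cauchy_schwarz _ _) c.
  rewrite lerNl; apply: le_trans c; rewrite -nrmN.
  by apply: le_trans (cauchy_schwarz _ _); rewrite /rdot innerNl raddfN.
have h5 : `|rdot l (w n)| <= `|M| + `|M'|.
  have := ler_norm M; have := ler_norm M'; have := normr_ge0 M; have := normr_ge0 M'.
  by rewrite ler_norml => ? ? ? ?; apply/andP; split; lra.
have h6 : n%:R < t ^+ n * nrm (w n).
  by rewrite mulrC /t exprVn ltr_pdivlMr// exprn_gt0.
lra.
Qed.

Lemma projection_op H (V : set H) : closed_subspace V ->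
  exists P : bounded_op H H,
    forall x, [/\ V (P x), orth V (x - P x) & nrm (P x) <= nrm x].
Proof.
move=> cV; have [sO _] := orth_closed_subspace V.
pose G x v := V v /\ orth V (x - v).
have Gle x v : G x v -> nrm v <= 1 * nrm x.
  move=> [Vv ov]; rewrite mul1r; have xE : x = v + (x - v) by rewrite addrC subrK.
  rewrite [in leRHS]xE nrm_orthoDl//.
  exact: orth_sym Vv ov.
have [||P PG] := @bounded_op_of_graph R H H G 1 _ _ Gle.
- by move=> x; have [v ? ?] := orth_projection x cV; exists v.
- move=> a x x' y y' [Vy oy] [Vy' oy']; split.
    by apply: (subspaceD cV.1) => //; exact: subspaceZ cV.1 _.
  rewrite opprD addrACA -scalerBr; apply: (subspaceD sO) => //.
  exact: subspaceZ sO _.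
exists P => x; have Gx := (PG x _).2 erefl.
by have [? ?] := Gx; split=> //; rewrite -[leRHS]mul1r Gle.
Qed.

(** Bounded right inverses on closed subspaces of the range. Compressing [A] to
the preimage of [V] makes [V] the full range; the adjoint is then bounded below
on [V] by uniform boundedness, hence maps [V] onto a closed subspace, and
preimages taken in that subspace have controlled norm. *)
Lemma open_mapping H K (A : bounded_op H K) (V : set K) :
  closed_subspace V -> V `<=` range A ->
  exists2 C : R, 0 < C & forall v, V v -> exists2 x, A x = v & nrm x <= C * nrm v.
Proof.
move=> cV VA.
have [P PP] := projection_op (preimage_closed_subspace A cV).
pose A0 := A \oB P.
have A0V x : V (A0 x) by have [] := PP x.
have VA0 v : V v -> exists x, A0 x = v.
  move=> Vv; have [x _ xv] := VA v Vv; exists x; rewrite bop_compE.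
  have Xx : (A @^-1` V) x by rewrite /= xv.
  have [Px oP _] := PP x.
  suff -> : P x = x by [].
  apply/esym/eqP; rewrite -subr_eq0; apply/eqP; apply: orth_cap oP.
  by apply: subspaceB => //; have [] := preimage_closed_subspace A cV.
have [|C C0 CB] := @uniform_boundedness K [set w | V w /\ nrm (adjoint A0 w) <= 1].
  (* for [w] in [V], pairing with [z] is pairing with [A0 x] *)
  move=> z; have [v Vv oz] := orth_projection z cV; have [x xv] := VA0 _ Vv.
  exists (nrm x) => w [Vw w1].
  have -> : rdot z w = rdot x (adjoint A0 w).
    by rewrite -(subrK v z) rdotDl rdot0 ?oz// add0r -xv /rdot adjointE.
  apply: (le_trans (cauchy_schwarz _ _)).
  by rewrite ler_piMr ?nrm_ge0.
have CV w : V w -> nrm w <= C * nrm (adjoint A0 w).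
  move=> Vw; set a := nrm (adjoint A0 w).
  have a0 : 0 <= a by exact: nrm_ge0.
  apply/ler_addgt0Pr => e e0; pose b := a + e / C.
  have eC : 0 < e / C by rewrite divr_gt0.
  have b0 : 0 < b by rewrite /b; lra.
  have := CB ((b^-1)%:C *: w); rewrite /= linearZ/= !nrmZr gtr0_norm ?invr_gt0// -/a.
  have -> : C * a + e = C * b by rewrite /b mulrDr mulrC [C * (e / C)]mulrC divfK ?gt_eqF// mulrC.
  rewrite mulrC -ler_pdivrMr// mulrC => h; rewrite mulrC; apply: h; split.
    exact: subspaceZ cV.1 _.
  by rewrite mulrC ler_pdivrMr// mul1r /b; lra.
have cI : closed_subspace (adjoint A0 @` V).
  apply: (@image_closed_subspace _ _ _ _ _ C^-1) => //; first by rewrite invr_gt0.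
  by move=> w Vw; rewrite mulrC ler_pdivrMr// mulrC CV.
exists C => // v Vv; have [x' xv] := VA0 _ Vv.
have [_ [w Vw <-]] := orth_projection x' cI; set u := adjoint A0 w => ou.
have A0u : A0 u = v.
  rewrite -xv; apply/esym/eqP; rewrite -subr_eq0 -linearB; apply/eqP.
  apply: (@orth_cap _ _ V); first exact: A0V.
  move=> y Vy; rewrite adjointE; apply: ou.
  by exists y.
exists (P u); first by rewrite -bop_compE.
have [_ _ Pu] := PP u; apply: (le_trans Pu).
have [->|u0] := eqVneq u 0; first by rewrite nrm0 mulr_ge0 ?nrm_ge0// ltW.
rewrite -nrm_gt0 in u0; rewrite -(ler_pM2l u0) -expr2 -rdotxx {2}/u /rdot -adjointE A0u.
apply: (le_trans (cauchy_schwarz _ _)).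
have := CV _ Vw; rewrite -/u => wu.
have := ler_wpM2l (nrm_ge0 v) wu; lra.
Qed.

End OpenMapping.

(** * Cutting a spectrum with moduli *)

Section Spectral.
Variable R : realType.
Implicit Types H K : hilbertType R.

Definition selfadjoint H (S : bounded_op H H) := is_adjoint S S.

(** The scalar majorant of the iteration for [1 - (1 - t)^{1/2}] at [t = 1]. Its
increments bound the norms of the increments of the operator iteration. *)
Fixpoint sqrt_bound (n : nat) : R :=
  if n is m.+1 then 2^-1 * (1 + sqrt_bound m ^+ 2) else 0.

Lemma sqrt_bound_mono n :
  [/\ 0 <= sqrt_bound n, sqrt_bound n <= 1 & sqrt_bound n <= sqrt_bound n.+1].
Proof.
elim: n => [|n [y0 y1 yS]]; first by split=> //=; nra.
have yS1 : sqrt_bound n.+1 <= 1 by move: y0 y1 => /=; nra.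
have yS0 : 0 <= sqrt_bound n.+1 by exact: le_trans yS.
split=> //; rewrite -/(sqrt_bound n.+1) [leRHS]/= -/(sqrt_bound n.+1).
by rewrite [leLHS]/=; move: yS yS0 yS1 y0; set z := sqrt_bound n.+1; nra.
Qed.

Section SquareRoot.
Variables (H : hilbertType R) (S : bounded_op H H).
Hypothesis S_sa : selfadjoint S.
Hypothesis S_le1 : forall x, nrm (S x) <= nrm x.

(* [1 - Q = S^2] is the operator whose square root is sought *)
Let Q : bounded_op H H := bounded_id - (S \oB S).

Fixpoint sqrt_approx (n : nat) : bounded_op H H :=
  if n is m.+1 then (2^-1)%:C *: (Q + (sqrt_approx m \oB sqrt_approx m)) else 0.
Local Notation Y := sqrt_approx.
Local Notation y := sqrt_bound.

Let YS n x : Y n.+1 x = (2^-1)%:C *: (Q x + Y n (Y n x)).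
Proof. by rewrite [Y n.+1]/= bopZE bopDE bop_compE. Qed.

Let QE x : Q x = x - S (S x).
Proof. by rewrite bopBE. Qed.

Let Q_le1 x : nrm (Q x) <= nrm x.
Proof.
rewrite -ler_sqr ?nnegrE ?nrm_ge0// QE nrm_sqB.
have -> : rdot x (S (S x)) = nrm (S x) ^+ 2 by rewrite -rdotxx /rdot S_sa.
have : nrm (S (S x)) ^+ 2 <= nrm (S x) ^+ 2.
  by rewrite ler_sqr ?nnegrE ?nrm_ge0.
have := sqr_ge0 (nrm (S x)); lra.
Qed.

Let Y_comm (T : bounded_op H H) n : (forall x, T (S x) = S (T x)) ->
  forall x, T (Y n x) = Y n (T x).
Proof.
move=> TS; elim: n => [|n IH] x; first by rewrite bop0.
by rewrite !YS bopZ bopD !IH !QE bopB !TS.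
Qed.

Let YSS n x : Y n (S x) = S (Y n x).
Proof. by rewrite (Y_comm (T := S)). Qed.

Let Y_sa n u v : '[Y n u, v] = '[u, Y n v].
Proof.
elim: n u v => [|n IH] u v; first by rewrite inner0l inner0r.
rewrite !YS innerZl innerZr innerDl innerDr !IH !QE innerBl innerBr !S_sa.
by rewrite conj_Creal// complex_real.
Qed.

Let Y_le n x : nrm (Y n x) <= y n * nrm x.
Proof.
elim: n x => [|n IH] x; first by rewrite nrm0 mul0r.
have [y0 _ _] := sqrt_bound_mono n.
rewrite YS nrmZr gtr0_norm ?invr_gt0// -mulrA ler_wpM2l ?invr_ge0//.
apply: (le_trans (nrmD _ _)); rewrite mulrDl mul1r lerD//.
apply: (le_trans (IH _)); rewrite expr2 -mulrA; exact: ler_wpM2l.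
Qed.

(* as the iterates commute, a difference of squares factors *)
Let Y_step n x : nrm (Y n.+1 x - Y n x) <= (y n.+1 - y n) * nrm x.
Proof.
elim: n x => [|n IH] x.
  have Y0 z : Y 0%N z = 0 by [].
  rewrite Y0 subr0 YS Y0 addr0 nrmZr gtr0_norm ?invr_gt0//=.
  by have := Q_le1 x; lra.
have -> : Y n.+2 x - Y n.+1 x =
    (2^-1)%:C *: (Y n.+1 (Y n.+1 x - Y n x) + Y n (Y n.+1 x - Y n x)).
  have ab : Y n.+1 (Y n x) = Y n (Y n.+1 x).
    by rewrite -(Y_comm (T := Y n.+1))// => z; exact: YSS.
  have e2 : Y n.+2 x = (2^-1)%:C *: (Q x + Y n.+1 (Y n.+1 x)) by exact: YS.
  have e1 : Y n.+1 x = (2^-1)%:C *: (Q x + Y n (Y n x)) by exact: YS.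
  rewrite e2 [X in _ - X]e1 -scalerBr; congr (_ *: _).
  by rewrite opprD addrACA subrr add0r !bopB ab addrA subrK.
have [y0 _ _] := sqrt_bound_mono n; have [y1 _ _] := sqrt_bound_mono n.+1.
rewrite nrmZr gtr0_norm ?invr_gt0//.
apply: (@le_trans _ _ (2^-1 * ((y n.+1 + y n) * ((y n.+1 - y n) * nrm x)))).
  rewrite ler_wpM2l ?invr_ge0//; apply: (le_trans (nrmD _ _)).
  rewrite mulrDl lerD//; apply: (le_trans (Y_le _ _)); exact: ler_wpM2l.
have -> : y n.+2 = 2^-1 * (1 + y n.+1 ^+ 2) by [].
have e : y n.+1 = 2^-1 * (1 + y n ^+ 2) by [].
rewrite [X in _ <= (_ - X) * _]e.
by have := nrm_ge0 x; lra.
Qed.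

Let Y_diff n k x : nrm (Y (n + k)%N x - Y n x) <= (y (n + k)%N - y n) * nrm x.
Proof.
elim: k => [|k IH]; first by rewrite addn0 !subrr mul0r nrm0.
apply: (le_trans (nrm_tri (Y (n + k)%N x) _ _)); rewrite addnS.
have := Y_step (n + k)%N x; move: IH; lra.
Qed.

Let converges (x l : H) :=
  forall e : R, 0 < e -> exists N, forall n, (N <= n)%N -> nrm (Y n x - l) <= e.

Let Y_cvg x : exists l, converges x l.
Proof.
pose D := range y.
have Dsup : has_sup D.
  split; first by exists (y 0%N), 0%N.
  by exists 1 => _ [n _ <-]; have [] := sqrt_bound_mono n.
have ysup n : y n <= sup D by apply: sup_upper_bound => //; exists n.
have x0 := nrm_ge0 x.
pose F e := [set z | exists2 n, z = Y n x & (sup D - y n) * nrm x <= e].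
have Fn e : 0 < e -> exists n, (sup D - y n) * nrm x <= e.
  move=> e0; have [|_ [n _ <-] yn] := @sup_adherent _ _ (e / (nrm x + 1)) _ Dsup.
    by rewrite divr_gt0//; lra.
  exists n; apply: (@le_trans _ _ (e / (nrm x + 1) * nrm x)).
    by rewrite ler_wpM2r//; lra.
  by rewrite mulrAC ler_pdivrMr; [nra|lra].
have FF n m : nrm (Y n x - Y m x) <= (sup D - y n) * nrm x + (sup D - y m) * nrm x.
  wlog nm : n m / (n <= m)%N.
    move=> W; have [/W//|/ltnW/W mn] := leqP n m.
    by rewrite nrmBC [leRHS]addrC.
  have := Y_diff n (m - n)%N x; rewrite subnKC// nrmBC.
  have := ysup m; nra.
have [||l lF] := @cauchy_family R H F.
- by move=> e /Fn[n en]; exists (Y n x), n.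
- move=> e d _ _ e0 d0 [n -> ne] [m -> md].
  by apply: (le_trans (FF n m)); exact: lerD.
exists l => e e0; have [N NP] := Fn e e0; exists N => n Nn.
apply: lF => //; exists n => //; apply: le_trans NP.
rewrite ler_wpM2r// lerB// -(subnKC Nn); elim: (n - N)%N => [|k IH]; first by rewrite addn0.
by rewrite addnS; apply: (le_trans IH); have [] := sqrt_bound_mono (N + k)%N.
Qed.

Let cvg_op : exists T : bounded_op H H, (forall x, converges x (T x)) /\
  forall x l, converges x l -> T x = l.
Proof.
have [|||T TP] := @bounded_op_of_graph R H H converges 1.
- exact: Y_cvg.
- move=> a x x' l l' xl xl' e e0; set r := complex.Re `|a|.
  have r0 : 0 <= r by exact: (nrm_ge0 (a : R[i]^o)).
  have [|N NP] := xl (e / 2 / (r + 1)); first by rewrite divr_gt0 ?divr_gt0//; lra.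
  have [|N' NP'] := xl' (e / 2); first by lra.
  exists (maxn N N') => n; rewrite geq_max => /andP[Nn N'n].
  rewrite bopD bopZ opprD addrACA -scalerBr (le_trans (nrmD _ _))// nrmZ -/r.
  have := NP' n N'n.
  have : r * nrm (Y n x - l) <= e / 2.
    apply: (le_trans (ler_wpM2l r0 (NP n Nn))).
    by rewrite mulrA ler_pdivrMr; [nra|lra].
  lra.
- move=> x l xl; apply/ler_addgt0Pr => e e0.
  have [N NP] := xl e e0; have := NP N (leqnn N); rewrite nrmBC.
  have := nrm_tri (Y N x) l 0; rewrite !subr0.
  have := Y_le N x; have [y0 y1 _] := sqrt_bound_mono N.
  have := nrm_ge0 x; nra.
by exists T; split=> [x|x l /TP->//]; exact/TP.
Qed.

(** The modulus [P = (S^2)^{1/2}] is [1 - T], where the limit [T] of the iterates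
satisfies [T = (1 - S^2 + T^2) / 2], that is [(1 - T)^2 = S^2]; positivity holds
because [T] is a contraction. *)
Lemma modulus_exists : exists P : bounded_op H H,
  [/\ selfadjoint P, forall x, 0 <= rdot (P x) x, forall x, P (P x) = S (S x)
    & forall x, P (S x) = S (P x)].
Proof.
have [T [Tc Tlim]] := cvg_op.
have T_le x : nrm (T x) <= nrm x.
  apply/ler_addgt0Pr => e e0.
  have [N NP] := Tc x e e0; have := NP N (leqnn N); rewrite nrmBC.
  have := nrm_tri (Y N x) (T x) 0; rewrite !subr0.
  have := Y_le N x; have [y0 y1 _] := sqrt_bound_mono N.
  have := nrm_ge0 x; nra.
have TS x : T (S x) = S (T x).
  apply: Tlim => e e0; have [N NP] := Tc x e e0; exists N => n Nn.
  by rewrite YSS -bopB; apply: (le_trans (S_le1 _)); exact: NP.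
have Y1 n x : nrm (Y n x) <= nrm x.
  apply: (le_trans (Y_le n x)); have [_ y1 _] := sqrt_bound_mono n.
  by rewrite ler_piMl ?nrm_ge0.
have Teq x : T x = (2^-1)%:C *: (Q x + T (T x)).
  apply: Tlim => e e0; have [N NP] := Tc x e e0; have [N' NP'] := Tc (T x) e e0.
  exists (maxn N N').+1 => -[//|n]; rewrite ltnS geq_max => /andP[Nn N'n].
  rewrite YS -scalerBr nrmZr gtr0_norm ?invr_gt0// opprD addrACA subrr add0r.
  have := nrm_tri (Y n (T x)) (Y n (Y n x)) (T (T x)).
  rewrite -bopB; have := Y1 n (Y n x - T x).
  have := NP n Nn; have := NP' n N'n; lra.
have Tsa_le u v : rdot (T u) v <= rdot u (T v).
  apply/ler_addgt0Pr => e e0; have u0 := nrm_ge0 u; have v0 := nrm_ge0 v.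
  set d := nrm u + nrm v + 1; have d0 : 0 < d by rewrite /d; lra.
  have ed : 0 < e / d by rewrite divr_gt0.
  have [N NP] := Tc u _ ed; have [N' NP'] := Tc v _ ed.
  set n := maxn N N'.
  have nu := NP n (leq_maxl _ _); have nv := NP' n (leq_maxr _ _).
  have -> : rdot (T u) v = rdot (T u - Y n u) v + rdot u (Y n v - T v) + rdot u (T v).
    rewrite rdotBl rdotBr -addrA subrK.
    have -> : rdot u (Y n v) = rdot (Y n u) v by rewrite /rdot Y_sa.
    by rewrite subrK.
  have := cauchy_schwarz (T u - Y n u) v; rewrite nrmBC.
  have := cauchy_schwarz u (Y n v - T v).
  have := ler_wpM2r v0 nu; have := ler_wpM2l u0 nv.
  have : nrm u * (e / d) + e / d * nrm v <= e.
    by rewrite mulrC -mulrDr mulrAC ler_pdivrMr// /d; nra.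
  lra.
have Tsa : selfadjoint T.
  move=> u v; apply: inner_eq_rdot => a; rewrite -bopZ; apply/le_anti.
  by rewrite Tsa_le/= rdotC [leRHS]rdotC Tsa_le.
exists (bounded_id - T); split.
- by move=> u v; rewrite !bopBE innerBl innerBr Tsa.
- move=> x; rewrite bopBE rdotBl rdotxx subr_ge0 (le_trans (cauchy_schwarz _ _))//.
  by rewrite expr2 ler_wpM2r ?nrm_ge0.
- move=> x; rewrite !bopBE /= bopB.
  have : T x + T x = Q x + T (T x) by rewrite {1 2}Teq -scalerDr half_double.
  rewrite QE => TT.
  have -> : x - T x - (T x - T (T x)) = x - (T x + T x) + T (T x).
    by rewrite opprB opprD !addrA addrAC.
  by rewrite TT opprD addrA subrK opprB addrC subrK.
- by move=> x; rewrite !bopBE /= TS bopB.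
Qed.

End SquareRoot.

(** The properties, used below, of the spectral subspace of [A^* A] above
[e^2]. *)
Definition cut H K (A : bounded_op H K) (e : R) (X : set H) :=
  [/\ closed_subspace X,
    forall x, X x -> e * nrm x <= nrm (A x),
    forall x, orth X x -> nrm (A x) <= e * nrm x &
    forall x y, X x -> orth X y -> '[A x, A y] = 0].

(** For the self-adjoint contraction [S], a positive multiple of [A^* A - e^2],
with modulus [P], take [X] to be the kernel of [P - S]. As
[(P - S)(P + S) = 0], the range of [P + S] lies in [X], so that [S = P] is
positive on [X] and [S = - P] is negative on its complement. *)
Lemma spectral_cut H K (A : bounded_op H K) (e : R) : 0 < e ->
  exists X : set H, cut A e X.
Proof.
move=> e0; pose S0 : bounded_op H H := (adjoint A \oB A) - (e ^+ 2)%:C *: bounded_id.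
have [M M0 MP] := bop_bound S0; pose m : R := M^-1.
have m0 : 0 < m by rewrite invr_gt0.
pose S : bounded_op H H := m%:C *: S0.
have S0E x : S0 x = adjoint A (A x) - (e ^+ 2)%:C *: x by [].
have SE x : S x = m%:C *: S0 x by [].
have AE x : adjoint A (A x) = M%:C *: S x + (e ^+ 2)%:C *: x.
  have mM : M%:C * m%:C = 1 :> R[i] by rewrite -rmorphM divff ?gt_eqF.
  by rewrite SE scalerA mM scale1r S0E subrK.
have Cr (r : R) : Num.conj r%:C = r%:C by rewrite conj_Creal// complex_real.
have S_sa : selfadjoint S.
  move=> x y; rewrite !SE innerZl innerZr Cr !S0E innerBl innerBr innerZl innerZr Cr.
  by rewrite adjointEl adjointE.
have S_le1 x : nrm (S x) <= nrm x.
  by rewrite SE nrmZr gtr0_norm// mulrC ler_pdivrMr// mulrC.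
have rSx x : rdot (S x) x = m * (nrm (A x) ^+ 2 - e ^+ 2 * nrm x ^+ 2).
  by rewrite SE rdotZl S0E rdotBl rdotZl rdotxx {1}/rdot adjointEl inner_nrm.
have [P [P_sa P_ge0 PP PS]] := modulus_exists S_sa S_le1.
pose X := (P - S) @^-1` [set 0].
have XE x : X x <-> P x = S x.
  change (P x - S x = 0 <-> P x = S x).
  by split=> [/eqP|->]; rewrite ?subrr// subr_eq0 => /eqP.
exists X; split.
- exact/preimage_closed_subspace/closed_subspace0.
- move=> x /XE Xx; have := P_ge0 x; rewrite Xx rSx pmulr_rge0// subr_ge0.
  by rewrite -exprMn ler_sqr// nnegrE ?mulr_ge0 ?nrm_ge0// ltW.
- move=> x ox.
  have SPx : S x = - P x.
    apply/eqP; rewrite -addr_eq0 addrC; apply/eqP/inner_ext => y; rewrite inner0l.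
    rewrite innerDl P_sa S_sa -innerDr ox//; apply/XE.
    by rewrite !bopD PP PS addrC.
  have := P_ge0 x.
  have -> : rdot (P x) x = - rdot (S x) x by rewrite SPx /rdot innerNl raddfN opprK.
  rewrite rSx oppr_ge0 pmulr_rle0// subr_le0.
  by rewrite -exprMn ler_sqr// nnegrE ?mulr_ge0 ?nrm_ge0// ltW.
- move=> x y /XE Xx oy; have SX : X (S x) by apply/XE; rewrite PS Xx.
  have SXy := orth_sym SX oy; have Xxy : '[x, y] = 0 by apply: orth_sym oy; exact/XE.
  by rewrite -adjointEl AE innerDl (innerZl M%:C) SXy innerZl Xxy !mulr0 addr0.
Qed.

End Spectral.

(** * Extending isometries to unitaries *)

Section Extension.
Variable R : realType.
Implicit Types H K : hilbertType R.

Lemma isometry_inner H K (U : bounded_op H K) : (forall x, nrm (U x) = nrm x) ->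
  forall x y, '[U x, U y] = '[x, y].
Proof.
move=> Un x y; apply: inner_polar => // a; last by rewrite -bopZ.
by rewrite -bopZ -bopD.
Qed.

Lemma pair_lin1 H K a (p q : H * K) : (a *: p + q).1 = a *: p.1 + q.1.
Proof. by []. Qed.

Lemma pair_lin2 H K a (p q : H * K) : (a *: p + q).2 = a *: p.2 + q.2.
Proof. by []. Qed.

(** A family of pairs with equal Gram matrices on both sides spans the graph of
an isometry, which extends by continuity when the first components are total. *)
Lemma isometric_extension H K (G : set (H * K)) :
  (forall p q, G p -> G q -> '[p.2, q.2] = '[p.1, q.1]) ->
  (forall x, orth (fst @` G) x -> x = 0) ->
  exists U : bounded_op H K,
    (forall x, nrm (U x) = nrm x) /\ forall p, G p -> U p.1 = p.2.
Proof.
move=> Giso Gtot.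
pose lin (Q : set (H * K)) := Q 0 /\ forall a p q, Q p -> Q q -> Q (a *: p + q).
(* the linear span of [G] *)
pose L : set (H * K) := [set p | forall Q, lin Q -> G `<=` Q -> Q p].
have GL : G `<=` L by move=> p Gp Q _; apply.
have Llin : lin L.
  split=> [Q [Q0 _] _//|a p q Lp Lq Q Qlin GQ].
  by apply: Qlin.2; [exact: Lp|exact: Lq].
have Liso p q : L p -> L q -> '[p.2, q.2] = '[p.1, q.1].
  pose Q p := [set q : H * K | '[p.2, q.2] = '[p.1, q.1]].
  have Qlin p' : lin (Q p').
    split; first by rewrite /Q /= !inner0r.
    move=> a r s /= pr ps.
    change ('[p'.2, a *: r.2 + s.2] = '[p'.1, a *: r.1 + s.1]).
    by rewrite !innerDr !innerZr pr ps.
  have GLQ p' : G p' -> L `<=` Q p'.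
    by move=> Gp' q' Lq'; apply: Lq' => // r Gr; exact: Giso.
  move=> Lp Lq; apply: (Lq _ (Qlin p)) => r Gr; rewrite /Q /= innerC [RHS]innerC.
  by congr Num.conj; exact: (GLQ r).
have Ldist p q : L p -> L q -> nrm (p.2 - q.2) = nrm (p.1 - q.1).
  move=> Lp Lq; have Lpq : L (p - q) by rewrite addrC -scaleN1r; exact: Llin.2.
  have iso : '[p.2 - q.2, p.2 - q.2] = '[p.1 - q.1, p.1 - q.1] := Liso _ _ Lpq Lpq.
  by apply/eqP; rewrite -(@eqrXn2 _ 2)// ?nrm_ge0// -!rdotxx /rdot iso.
have Lapprox x e : 0 < e -> exists2 p, L p & nrm (x - p.1) < e.
  have sL : subspace (fst @` L).
    apply/subspaceP; split; first by exists 0 => //; exact: Llin.1.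
    by move=> a _ _ [p Lp <-] [q Lq <-]; exists (a *: p + q) => //; exact: Llin.2.
  have : closure (fst @` L) x.
    rewrite -orth_orth_closure// => y oy; rewrite (Gtot y) ?inner0r// => _ [p Gp <-].
    by apply: oy; exists p => //; exact: GL.
  by move=> /nrm_closureP h /h[_ [p Lp <-] xp]; exists p.
(* the closure of [L] *)
pose graph x y := forall e : R, 0 < e ->
  exists p, [/\ L p, nrm (x - p.1) <= e & nrm (y - p.2) <= e].
have graph_nrm x y : graph x y -> nrm y = nrm x.
  move=> xy; have h e : 0 < e -> nrm y <= nrm x + e /\ nrm x <= nrm y + e.
    move=> e0; have [|p [Lp xp yp]] := xy (e / 2); first lra.
    have := Ldist _ 0 Lp Llin.1; rewrite !subr0 => p12.
    have := nrm_tri p.1 x 0; have := nrm_tri x p.1 0.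
    have := nrm_tri p.2 y 0; have := nrm_tri y p.2 0.
    by rewrite !subr0 (nrmBC p.1) (nrmBC p.2); split; lra.
  by apply/le_anti/andP; split; apply/ler_addgt0Pr => e /h[].
have [|||U UG] := @bounded_op_of_graph R H K graph 1.
- move=> x; pose F e := [set y | exists2 p, L p & y = p.2 /\ nrm (x - p.1) <= e].
  have [||l lF] := @cauchy_family R K F.
  + by move=> e /(Lapprox x)[p Lp xp]; exists p.2, p => //; split=> //; exact: ltW.
  + move=> e d _ _ e0 d0 [p Lp [-> xp]] [q Lq [-> xq]]; rewrite Ldist//.
    by have := nrm_tri x p.1 q.1; rewrite (nrmBC p.1 x); lra.
  exists l => e e0; have [p Lp xp] := Lapprox x e e0.
  exists p; split=> //; first exact: ltW.
  by rewrite nrmBC; apply: lF => //; exists p => //; split=> //; exact: ltW.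
- move=> a x x' y y' xy xy' e e0; set r := complex.Re `|a|.
  have r0 : 0 <= r by exact: (nrm_ge0 (a : R[i]^o)).
  have d0 : 0 < e / 2 / (r + 1) by rewrite divr_gt0 ?divr_gt0//; lra.
  have dr : r * (e / 2 / (r + 1)) <= e / 2.
    by rewrite mulrA ler_pdivrMr; [nra|lra].
  have [p [Lp xp yp]] := xy _ d0; have [|q [Lq xq yq]] := xy' (e / 2); first lra.
  exists (a *: p + q); split; first exact: Llin.2.
    rewrite pair_lin1 opprD addrACA -scalerBr (le_trans (nrmD _ _))// nrmZ -/r.
    have := ler_wpM2l r0 xp; lra.
  rewrite pair_lin2 opprD addrACA -scalerBr (le_trans (nrmD _ _))// nrmZ -/r.
  have := ler_wpM2l r0 yp; lra.
- by move=> x y /graph_nrm ->; rewrite mul1r.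
exists U; split=> [x|p Gp]; first exact/graph_nrm/UG.
apply/esym/UG => e e0; exists p; split; first exact: GL.
  by rewrite subrr nrm0 ltW.
by rewrite subrr nrm0 ltW.
Qed.

(** Adjoining to [G] the pairs of a bijection between orthonormal bases of the
two complements preserves Gram matrices and makes both sides total. *)
Lemma unitary_extension H (G : set (H * H)) (V V' : set H) :
  (forall p q, G p -> G q -> '[p.2, q.2] = '[p.1, q.1]) ->
  fst @` G = V -> snd @` G = V' -> hdim (orth V) #= hdim (orth V') ->
  exists2 U : bounded_op H H, unitary_op U & forall p, G p -> U p.1 = p.2.
Proof.
move=> Giso GV GV' dimVV'.
have cO := orth_closed_subspace V; have cO' := orth_closed_subspace V'.
have oS := hdim_onb cO; have oS' := hdim_onb cO'.
have [SV oSS _] := oS; have [SV' oSS' _] := oS'.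
have /card_set_bijP[f [fS finj fonto]] := dimVV'.
set S := hdim (orth V) in SV oSS oS fS finj fonto.
set S' := hdim (orth V') in SV' oSS' oS' fS fonto.
pose F := G `|` [set (e, f e) | e in S].
have GP p : G p -> V p.1 /\ V' p.2.
  by move=> Gp; split; [rewrite -GV|rewrite -GV']; exists p.
have Fiso p q : F p -> F q -> '[p.2, q.2] = '[p.1, q.1].
  case=> [Gp|[e Se <-]] [Gq|[e' Se' <-]] /=; first exact: Giso.
  - have [Vp V'p] := GP _ Gp.
    by rewrite (orth_sym Vp (SV _ Se')) (orth_sym V'p (SV' _ (fS _ Se'))).
  - have [Vq V'q] := GP _ Gq.
    by rewrite (SV _ Se _ Vq) (SV' _ (fS _ Se) _ V'q).
  - have Sfe := fS _ Se; have Sfe' := fS _ Se'.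
    rewrite (oSS e)// (oSS' (f e))//; congr (nat_of_bool _)%:R.
    apply/eqP/eqP => [|->//]; apply: finj; exact/mem_set.
have Ftot x : orth (fst @` F) x -> x = 0.
  move=> Fx; have Vx : orth V x.
    by move=> y; rewrite -GV => -[p Gp <-]; apply: Fx; exists p => //; left.
  apply: (orth_cap Vx); rewrite -(orth_onb cO oS) => e Se.
  by apply: Fx; exists (e, f e) => //; right; exists e.
have Ftot' x : orth (snd @` F) x -> x = 0.
  move=> Fx; have Vx : orth V' x.
    by move=> y; rewrite -GV' => -[p Gp <-]; apply: Fx; exists p => //; left.
  apply: (orth_cap Vx); rewrite -(orth_onb cO' oS') => _ /fonto[e Se <-].
  by apply: Fx; exists (e, f e) => //; right; exists e.
have [U [Un UF]] := isometric_extension Fiso Ftot.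
exists U; last by move=> p Gp; apply: UF; left.
apply: unitary_onto; first exact: isometry_inner.
have cT : closed_subspace [set: H] by split; [exact/subspaceP|exact: closedT].
have cR : closed_subspace (range U).
  by apply: (image_closed_subspace cT ltr01) => x _; rewrite mul1r Un.
move=> y; suff [x _ <-] : range U y by exists x.
apply: (orthK cR) => z oz; rewrite (Ftot' z) ?inner0r// => _ [p Fp <-].
by apply: oz; exists p.1 => //; exact: UF.
Qed.

End Extension.

(** * Indices of an operator and unitary orbits *)

Section Indices.
Variable R : realType.
Implicit Types H K : hilbertType R.

Let range_sub H K (A : bounded_op H K) : range A `<=` closure (range A).
Proof. exact: subset_closure. Qed.

Lemma iota_f_orth H K (A : bounded_op H K) (V : set K) :
  closed_subspace V -> V `<=` range A ->
  hdim (ominus (closure (range A)) V) #= IC (range A) ->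
  iota_f A #= hdim (orth V).
Proof.
move=> cV VA e; rewrite card_eq_sym.
have cl := closure_subspace (range_subspace A).
apply: (card_eq_trans (hdim_orth_sum cV cl _)); first exact: (subset_trans VA (@range_sub _ _ A)).
by rewrite /iota_f ominusT; apply: card_sum_eq => //; exact: card_eqxx.
Qed.

Lemma iota_f_le_orth H K (A : bounded_op H K) (V : set K) :
  closed_subspace V -> V `<=` range A -> iota_f A #<= hdim (orth V).
Proof.
move=> cV VA; have cl := closure_subspace (range_subspace A).
have VE : V `<=` closure (range A) by exact: (subset_trans VA (@range_sub _ _ A)).
have := hdim_orth_sum cV cl VE; rewrite card_eq_sym card_eq_le => /andP[h _].
apply: card_le_trans h; rewrite /iota_f ominusT; apply: card_sum_le.
  exact: card_lexx.
by have [_] := IC_spec (range_subspace A); apply.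
Qed.

(** [V] is optimal for [IC] as soon as [A] is close enough to its compression
into [V]: a vector orthogonal to [V] inside an optimal subspace has a
controlled preimage under [A], so it would be a small part of itself. *)
Lemma IC_attained_near H K (A : bounded_op H K) : exists2 d : R, 0 < d &
  forall V, closed_subspace V -> V `<=` range A ->
    (forall x, exists2 v, V v & orth V (A x - v) /\ nrm (A x - v) <= d * nrm x) ->
    hdim (ominus (closure (range A)) V) #= IC (range A).
Proof.
have sA := range_subspace A; have cl := closure_subspace sA.
have [[W [WA cW ICW]] ICmin] := IC_spec sA.
have [C C0 CP] := open_mapping cW WA.
exists ((2 * C)^-1); first by rewrite invr_gt0 mulr_gt0.
move=> V cV VA Vd; rewrite card_eq_le ICmin// andbT ICW.
apply: hdim_cap0; [exact: ominus_closed_subspace|exact: ominus_closed_subspace|].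
move=> x [clx oVx] ox.
have [p Wp op] := orth_projection x cW.
have clp : closure (range A) p by exact/range_sub/WA.
have Nq : ominus (closure (range A)) W (x - p).
  by split=> //; exact: (subspaceB cl.1).
have xp0 : x - p = 0.
  by apply/inner_eq0; rewrite {1}innerBl ox// (orth_sym Wp op) subr0.
have Wx : W x by have /eqP := xp0; rewrite subr_eq0 => /eqP ->.
have [a ax aC] := CP _ Wx; have [v Vv [ov vd]] := Vd a.
rewrite ax in ov vd.
have v0 : v = 0.
  apply: (orth_cap Vv) => y Vy; have := ov _ Vy; rewrite innerBl oVx// sub0r.
  by move/eqP; rewrite oppr_eq0 => /eqP.
rewrite v0 subr0 in vd; apply: nrm_le0.
have : (2 * C)^-1 * nrm a <= nrm x / 2.
  by rewrite mulrC ler_pdivrMr ?mulr_gt0//; lra.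
have := nrm_ge0 x; lra.
Qed.

Lemma iota_f_cut H K (A : bounded_op H K) : exists2 d : R, 0 < d &
  forall e X, 0 < e -> e <= d -> cut A e X -> iota_f A #= hdim (orth (A @` X)).
Proof.
have [d d0 dP] := IC_attained_near A; exists d => // e X e0 ed [cX Xlow Xup Xo].
have cV := image_closed_subspace cX e0 Xlow.
have VA : A @` X `<=` range A by move=> _ [x _ <-]; exists x.
apply: iota_f_orth => //; apply: dP => // x.
have [p Xp op] := orth_projection x cX; exists (A p); first by exists p.
rewrite -bopB; split; first by move=> _ [y Xy <-]; rewrite inner0C// Xo.
apply: (le_trans (Xup _ op)); apply: ler_pM => //; rewrite ?nrm_ge0 ?(ltW e0)//.
by rewrite -{2}(subrK p x) nrm_orthoDl// inner0C// (orth_sym Xp op).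
Qed.

(** If [V] is optimal for [A] and [U A] is close to [B], no nonzero vector of
[U V] is orthogonal to [V' = B (A^-1 V)]. So the adjoint of [U] sends no nonzero
vector of the complement of [V'] into [V], and the complement of [V'] is not
larger than that of [V]. *)
Lemma iota_f_le_of_near H K (A B : bounded_op H K) :
  (forall x, nrm (A x) = nrm (B x)) ->
  (forall e : R, 0 < e -> exists2 U : bounded_op K K, unitary_op U &
     forall x, nrm (B x - U (A x)) <= e * nrm x) ->
  iota_f B #<= iota_f A.
Proof.
move=> AB near.
have sA := range_subspace A.
have [[V [VA cV ICV]] _] := IC_spec sA.
have [C C0 CP] := open_mapping cV VA.
have [|U uU UP] := near ((2 * C)^-1); first by rewrite invr_gt0 mulr_gt0.
have [Un UK UK'] := unitary_isometry uU.
pose V' := B @` (A @^-1` V).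
(* [A x |-> B x] is isometric, so limits in [V'] come from limits in [V] *)
have cV' : closed_subspace V'.
  have [/subspaceP[X0 XD] cX] := preimage_closed_subspace A cV.
  split.
    apply/subspaceP; split; first by exists 0; rewrite ?bop0.
    move=> a _ _ [x Vx <-] [y Vy <-]; exists (a *: x + y); first exact: XD.
    by rewrite bopD bopZ.
  apply: closed_approxP => y yV.
  pose F e := [set v | exists x, [/\ V (A x), v = A x & nrm (y - B x) < e]].
  have [||l lF] := @cauchy_family R K F.
  - by move=> e e0; have [_ [x Vx <-] xy] := yV e e0; exists (A x), x.
  - move=> e d _ _ e0 d0 [x [Vx -> xe]] [x' [Vx' -> xd]].
    rewrite -bopB AB bopB; have := nrm_tri y (B x) (B x').
    by rewrite (nrmBC (B x) y); lra.
  have Vl : V l.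
    apply: (closed_approx cV.2) => e e0.
    have [|_ [x Vx <-] xy] := yV (e / 2); first lra.
    exists (A x) => //; rewrite nrmBC.
    apply: (@le_lt_trans _ _ (e / 2)); last lra.
    by apply: lF; [lra|exists x].
  have [a _ al] := VA _ Vl; exists a; first by rewrite /= al.
  apply/eqP; rewrite -subr_eq0; apply/eqP/nrm_le0/ler_addgt0Pr => e e0.
  have [|_ [x Vx <-] xy] := yV (e / 2); first lra.
  have : nrm (A x - l) <= e / 2 by apply: lF; [lra|exists x].
  rewrite -al -bopB AB bopB nrmBC => h.
  have := nrm_tri (B x) (B a) y; rewrite (nrmBC (B x) y); lra.
have V'B : V' `<=` range B by move=> _ [x _ <-]; exists x.
apply: (card_le_trans (iota_f_le_orth cV' V'B)).
have : iota_f A #= hdim (orth V) by apply: iota_f_orth => //; rewrite ICV; exact: card_eqxx.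
rewrite card_eq_sym card_eq_le => /andP[h _]; apply: card_le_trans h.
apply: (hdim_le (T := adjoint U)); [exact: orth_closed_subspace|exact: orth_closed_subspace|].
move=> y oy /(orthK cV) Vy.
(* [y = U v] with [v] in [V], while [y] is orthogonal to the nearby [B a] *)
have [a av aC] := CP _ Vy.
have yBa : '[y, B a] = 0 by apply: oy; exists a => //; rewrite /= av.
have yE : U (A a) = y by rewrite av UK'.
have := UP a; rewrite yE => h.
have yn : nrm (adjoint U y) = nrm y by rewrite -[in RHS]yE av Un.
have h1 : nrm y <= nrm (B a - y).
  rewrite nrmBC; apply: nrm_orthoDl; by rewrite innerNr yBa oppr0.
rewrite yn in aC; apply: nrm_le0.
have : (2 * C)^-1 * nrm a <= nrm y / 2.
  by rewrite mulrC ler_pdivrMr ?mulr_gt0//; lra.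
have := nrm_ge0 y; lra.
Qed.

Lemma closure_left_orbit H K (A B : bounded_op H K) :
  closure [set U \oB A | U in @unitary_op R K] B <->
  adjoint B \oB B = adjoint A \oB A /\ iota_f B #= iota_f A.
Proof.
split.
  move=> /closure_orbitP near.
  have AB x : nrm (A x) = nrm (B x).
    have h e : 0 < e -> nrm (A x) <= nrm (B x) + e /\ nrm (B x) <= nrm (A x) + e.
      move=> e0; have x0 := nrm_ge0 x.
      have [|U uU /(_ x)] := near (e / (nrm x + 1)); first by rewrite divr_gt0//; lra.
      have [Un _ _] := unitary_isometry uU; rewrite bop_compE => UP.
      have : e / (nrm x + 1) * nrm x <= e.
        by rewrite mulrAC ler_pdivrMr; [nra|lra].
      have := nrm_tri (B x) (U (A x)) 0; have := nrm_tri (U (A x)) (B x) 0.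
      by rewrite !subr0 Un (nrmBC (U (A x))); split; lra.
    by apply/le_anti/andP; split; apply/ler_addgt0Pr => e /h[].
  split; first exact/gram_eq.
  rewrite card_eq_le; apply/andP; split.
    by apply: iota_f_le_of_near => // e /near[U uU UP]; exists U.
  apply: iota_f_le_of_near => // e /near[U uU UP]; exists (adjoint U).
    exact: unitary_adjoint.
  have [Un UK UK'] := unitary_isometry uU; move=> x.
  by rewrite -Un bopB UK' -nrmN opprB; exact: UP.
move=> [AB iotaAB]; apply/closure_orbitP => e e0.
have ABn := (gram_eq _ _).1 AB; have ABi := gram_inner AB.
have [dA dA0 dAP] := iota_f_cut A; have [dB dB0 dBP] := iota_f_cut B.
pose d := Num.min (Num.min dA dB) (e / 2).
have d0 : 0 < d by rewrite !lt_min dA0 dB0/=; lra.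
have ddA : d <= dA by rewrite !ge_min lexx.
have ddB : d <= dB by rewrite !ge_min lexx orbT.
have de : d <= e / 2 by rewrite ge_min lexx orbT.
have [X cutX] := spectral_cut A d0; have [cX Xlow Xup Xo] := cutX.
(* [cut] depends on [A] only through [A^* A] *)
have cutX' : cut B d X.
  by split=> // [x|x|x y]; rewrite ?ABn ?ABi; [exact: Xlow|exact: Xup|exact: Xo].
have dims : hdim (orth (A @` X)) #= hdim (orth (B @` X)).
  have h1 := dAP d X d0 ddA cutX; have h2 := dBP d X d0 ddB cutX'.
  apply: card_eq_trans h2; rewrite card_eq_sym in h1; apply: (card_eq_trans h1).
  by rewrite card_eq_sym.
pose G := [set (A x, B x) | x in X].
have [||||U uU UG] := @unitary_extension R K G (A @` X) (B @` X).
- by move=> _ _ [x Xx <-] [y Xy <-] /=; rewrite ABi.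
- by rewrite /G image_comp.
- by rewrite /G image_comp.
- exact: dims.
exists U => // x; rewrite bop_compE; have [Un _ _] := unitary_isometry uU.
have [p Xp op] := orth_projection x cX.
(* [U A] and [B] agree at [p] and are both small at [x - p] *)
have -> : B x - U (A x) = B (x - p) - U (A (x - p)).
  by rewrite !bopB (UG (A p, B p))/= ?opprB ?addrA ?subrK//; exists p.
apply: (le_trans (nrmB _ _)); rewrite Un ABn -mulr2n.
have xp : nrm (x - p) <= nrm x.
  by rewrite -{2}(subrK p x) nrm_orthoDl// inner0C// (orth_sym Xp op).
have := Xup _ op; have := nrm_ge0 (x - p); have := nrm_ge0 x; nra.
Qed.

(** [A] compares the two defects: it is injective on the closure of the range
of [A^*] and maps the complement of [A^* V] to the complement of [V]. *)
Lemma IC_adjoint_le H K (A : bounded_op H K) :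
  IC (range (adjoint A)) #<= IC (range A).
Proof.
have sA := range_subspace A; have sA' := range_subspace (adjoint A).
have [[V [VA cV ICV]] _] := IC_spec sA; have [_ ICmin] := IC_spec sA'.
have [C C0 CP] := open_mapping cV VA.
have cV' : closed_subspace (adjoint A @` V).
  apply: (@image_closed_subspace _ _ _ _ _ C^-1) => //; first by rewrite invr_gt0.
  move=> v Vv; have [x xv xC] := CP _ Vv; rewrite mulrC ler_pdivrMr// mulrC.
  have [->|v0] := eqVneq v 0; first by rewrite nrm0 mulr_ge0 ?nrm_ge0// ltW.
  rewrite -nrm_gt0 in v0; rewrite -(ler_pM2l v0) -expr2 -rdotxx -{1}xv /rdot adjointE.
  apply: (le_trans (cauchy_schwarz _ _)).
  have := ler_wpM2r (nrm_ge0 (adjoint A v)) xC; lra.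
apply: (@card_le_trans _ _ _ (hdim (ominus (closure (range (adjoint A))) (adjoint A @` V)))).
  by apply: ICmin => // _ [v _ <-]; exists v.
rewrite ICV; have cl := closure_subspace sA; have cl' := closure_subspace sA'.
apply: (hdim_le (T := A)); [exact: ominus_closed_subspace|exact: ominus_closed_subspace|].
move=> x [clx ox] oAx; apply: (orth_cap clx).
rewrite orth_closure orth_range adjointK /=; apply: orth_cap oAx; split.
  by apply: subset_closure; exists x.
by move=> v Vv; rewrite adjointE ox//; exists v.
Qed.

Lemma iota_i_adjoint H K (A : bounded_op H K) : iota_i A #= iota_f (adjoint A).
Proof.
rewrite /iota_i /iota_f ominusT orth_closure orth_range adjointK.
apply: card_sum_eq; first exact: card_eqxx.
rewrite card_eq_le IC_adjoint_le andbT -{1}(adjointK A); exact: IC_adjoint_le.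
Qed.

(** Adjunction exchanges the two kinds of orbits and preserves the operator
norm. *)
Lemma closure_right_orbit_adjoint H K (A B : bounded_op H K) :
  closure [set A \oB U | U in @unitary_op R H] B <->
  closure [set U \oB adjoint A | U in @unitary_op R H] (adjoint B).
Proof.
rewrite !closure_orbitP; split=> near e e0; have [U uU UP] := near e e0;
    exists (adjoint U); try exact: unitary_adjoint; move=> x.
  have := @adjoint_bound _ _ _ (B - (A \oB U)) e (ltW e0) UP x.
  by rewrite adjointB adjoint_comp.
have := @adjoint_bound _ _ _ (adjoint B - (U \oB adjoint A)) e (ltW e0) UP x.
by rewrite adjointB adjoint_comp !adjointK.
Qed.

End Indices.

Theorem theorem6p1 (R : realType) (H K : hilbertType R) (A : bounded_op H K) :
  closure [set U \oB A | U in @unitary_op R K] =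
    [set B : bounded_op H K |
      adjoint B \oB B = adjoint A \oB A /\ iota_f B #= iota_f A]
  /\
  closure [set A \oB U | U in @unitary_op R H] =
    [set B : bounded_op H K |
      B \oB adjoint B = A \oB adjoint A /\ iota_i B #= iota_i A].
Proof.
split; apply/seteqP; split=> B /=; try by move/closure_left_orbit.
  move=> /closure_right_orbit_adjoint/closure_left_orbit[]; rewrite !adjointK => AB iAB.
  split=> //; apply: (card_eq_trans (iota_i_adjoint B)); apply: (card_eq_trans iAB).
  by rewrite card_eq_sym; exact: iota_i_adjoint.
move=> [AB iAB]; apply/closure_right_orbit_adjoint/closure_left_orbit.
rewrite !adjointK; split=> //; rewrite card_eq_sym.
have := iota_i_adjoint A; rewrite card_eq_sym => h; apply: (card_eq_trans h).
by rewrite card_eq_sym in iAB; apply: (card_eq_trans iAB); exact: iota_i_adjoint.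
Qed.
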